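(* Let $p$ be a prime number with $p\equiv 17 \pmod{24}$ and $\left(\frac{2}{p}\right)_4=1$, and let $E_p$ be the elliptic curve over $\mathbb{Q}$ given by $Y^2=(X-p)^3+X^3+(X+p)^3$. If there are integers $a,b$ such that $3p=a^4+2b^4$, then $\operatorname{rank}(E_p(\mathbb{Q}))=1$.
   Context: $\operatorname{rank}(E_p(\mathbb{Q}))$ denotes the rank of the finitely generated abelian group $E_p(\mathbb{Q})$ (the Mordell-Weil group). For a prime $p\equiv 1\pmod 8$ (so that $2$ is a square mod $p$), $\left(\frac{2}{p}\right)_4$ denotes the rational quartic residue symbol: it equals $1$ if $2$ is a fourth power modulo $p$ and $-1$ otherwise. The change of variables $x=3X$, $y=3Y$ brings $E_p$ to the form $y^2=x^3+18p^2x$. *)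

(* Defs.v *)
From HB Require Import structures.
From mathcomp Require Import all_boot all_order all_algebra separable.
From mathcomp Require Import ring.

Set Implicit Arguments.
Unset Strict Implicit.
Unset Printing Implicit Defensive.

Import Order.TTheory GRing.Theory Num.Theory.
Local Open Scope ring_scope.

(* Elliptic curves Y^2 = f(X), where f is a cubic without multiple roots and
   not necessarily monic.  The origin is the point at infinity (0 : 1 : 0),
   which is a flex, so P + Q + R = 0 iff P, Q, R are the three intersection
   points of the curve with a line. *)

Record ellcurve (F : numFieldType) := EllCurve {
  cubic : {poly F};
  size_cubic : size cubic = 4%N;
  separable_cubic : separable_poly cubic
}.

Section RawGroupLaw.

Variables (F : numFieldType) (E : ellcurve F).
Local Notation f := (cubic E).

(* None is the point at infinity. *)
Definition on_curve (P : option (F * F)) : bool :=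
  if P is Some (x, y) then y ^+ 2 == f.[x] else true.

Definition ec_slope (P Q : F * F) : F :=
  if P.1 == Q.1 then f^`().[P.1] / (2%:R * P.2)
  else (Q.2 - P.2) / (Q.1 - P.1).

Definition ec_opp (P : option (F * F)) : option (F * F) :=
  if P is Some (x, y) then Some (x, - y) else None.

(* Substituting Y = y1 + m (X - x1) in Y^2 = f(X), the roots x1, x2, x3 satisfy
   x1 + x2 + x3 = (m^2 - f_2) / f_3. *)
Definition ec_add (P Q : option (F * F)) : option (F * F) :=
  match P, Q with
  | None, _ => Q
  | _, None => P
  | Some (x1, y1), Some (x2, y2) =>
      if (x1 == x2) && (y1 == - y2) then None else
      let m := ec_slope (x1, y1) (x2, y2) in
      let x3 := (m ^+ 2 - f`_2) / f`_3 - x1 - x2 in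
      Some (x3, - (y1 + m * (x3 - x1)))
  end.

Let c := f`_3.
Let a := f`_2.
Let b := f`_1.
Let d := f`_0.

Let c_neq0 : c != 0.
Proof.
rewrite /c -[3%N]/(4.-1) -(size_cubic E) -lead_coefE lead_coef_eq0.
by rewrite -size_poly_eq0 size_cubic.
Qed.

Lemma horner_cubic x : f.[x] = c * x ^+ 3 + a * x ^+ 2 + b * x + d.
Proof.
rewrite horner_coef size_cubic !big_ord_recr big_ord0 /= -/a -/b -/c -/d; ring.
Qed.

Lemma horner_deriv_cubic x :
  f^`().[x] = 3%:R * c * x ^+ 2 + 2%:R * a * x + b.
Proof.
have sz : (size f^`() <= 3)%N.
  by rewrite -ltnS -(size_cubic E) lt_size_deriv // -size_poly_eq0 size_cubic.
rewrite (horner_coef_wide _ sz) !big_ord_recr big_ord0 /= !coef_deriv.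
rewrite -/a -/b -/c; ring.
Qed.

Lemma cubic_smooth x : f.[x] = 0 -> f^`().[x] != 0.
Proof.
move=> fx0; have := separable_cubic E; rewrite unlock => cop.
by apply: (coprimep_root cop); apply/rootP.
Qed.

Let is_slope (x1 y1 x2 y2 m : F) : Prop :=
  y2 - y1 = m * (x2 - x1) /\
  m * (y1 + y2) = c * (x1 ^+ 2 + x1 * x2 + x2 ^+ 2) + a * (x1 + x2) + b.

Let X3 (m x1 x2 : F) : F := (m ^+ 2 - a) / c - x1 - x2.
Let Y3 (m x1 y1 x2 : F) : F := - (y1 + m * (X3 m x1 x2 - x1)).

Let C (x y : F) : Prop := y ^+ 2 = c * x ^+ 3 + a * x ^+ 2 + b * x + d.

Let on_curveP x y : reflect (C x y) (on_curve (Some (x, y))).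
Proof. by rewrite /= horner_cubic; apply: eqP. Qed.

Let two_neq0 : 2%:R != 0 :> F. Proof. by rewrite pnatr_eq0. Qed.

Let same_x x y y' : C x y -> C x y' -> y' = y \/ y = - y'.
Proof.
rewrite /C => e1 e2; have /eqP : y ^+ 2 = y' ^+ 2 by rewrite e1 e2.
by rewrite eqf_sqr => /orP[]/eqP ->; [left | right].
Qed.

Let slope_uniq x1 y1 x2 y2 m m' : C x1 y1 -> C x2 y2 ->
  ~ (x1 = x2 /\ y1 = - y2) ->
  is_slope x1 y1 x2 y2 m -> is_slope x1 y1 x2 y2 m' -> m = m'.
Proof.
move=> C1 C2 ne [e1 e2] [e1' e2'].
have [ex|nx] := eqVneq x1 x2; last first.
  have nz : x2 - x1 != 0 by rewrite subr_eq0 eq_sym.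
  by apply: (mulIf nz); rewrite -e1 -e1'.
have nz : y1 + y2 != 0 by apply/eqP => /addr0_eq e; apply: ne; rewrite -e opprK.
by apply: (mulIf nz); rewrite e2 e2'.
Qed.

Let slopeP x1 y1 x2 y2 : C x1 y1 -> C x2 y2 -> ~ (x1 = x2 /\ y1 = - y2) ->
  is_slope x1 y1 x2 y2 (ec_slope (x1, y1) (x2, y2)).
Proof.
move=> C1 C2 ne; rewrite /is_slope /ec_slope /=; have [ex|nx] := eqVneq x1 x2.
  rewrite -ex in C2 ne *; have [ey|ey] := same_x C1 C2; last by case: ne.
  rewrite ey in ne *.
  have y0 : y1 != 0 by apply/eqP => y0; apply: ne; rewrite y0 oppr0.
  rewrite horner_deriv_cubic; split; first by rewrite !subrr mulr0.
  by field; rewrite ?y0 ?two_neq0.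
have nz : x2 - x1 != 0 by rewrite subr_eq0 eq_sym.
split; first by rewrite divfK.
apply: (mulIf nz); rewrite mulrAC divfK //.
have -> : (y2 - y1) * (y1 + y2) = y2 ^+ 2 - y1 ^+ 2 by ring.
rewrite C1 C2; ring.
Qed.

Let addP x1 y1 x2 y2 m : C x1 y1 -> C x2 y2 -> ~ (x1 = x2 /\ y1 = - y2) ->
  is_slope x1 y1 x2 y2 m ->
  ec_add (Some (x1, y1)) (Some (x2, y2)) = Some (X3 m x1 x2, Y3 m x1 y1 x2).
Proof.
move=> C1 C2 ne sl; have sl' := slopeP C1 C2 ne.
rewrite (slope_uniq C1 C2 ne sl sl') /=.
by case: ifP => // /andP[/eqP e1 /eqP e2]; case: ne.
Qed.

Let add_opp x y : ec_add (Some (x, y)) (Some (x, - y)) = None.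
Proof. by rewrite /= opprK !eqxx. Qed.

Let C_third x1 y1 x2 y2 m : C x1 y1 -> is_slope x1 y1 x2 y2 m ->
  C (X3 m x1 x2) (Y3 m x1 y1 x2).
Proof.
rewrite /C /is_slope /Y3 => C1 [e1 e2].
have y2E : y2 = y1 + m * (x2 - x1) by rewrite -e1; ring.
have bE : b = m * (y1 + y2) - c * (x1 ^+ 2 + x1 * x2 + x2 ^+ 2) - a * (x1 + x2).
  by rewrite e2; ring.
have dE : d = y1 ^+ 2 - c * x1 ^+ 3 - a * x1 ^+ 2 - b * x1 by rewrite C1; ring.
rewrite dE bE y2E /X3; field; exact: c_neq0.
Qed.

Lemma ec_add_on P Q : on_curve P -> on_curve Q -> on_curve (ec_add P Q).
Proof.
case: P Q => [[x1 y1]|] [[x2 y2]|] // /on_curveP C1 /on_curveP C2.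
have [/andP[e1 e2]|ne] := boolP ((x1 == x2) && (y1 == - y2)).
  by rewrite /= e1 e2.
have {}ne : ~ (x1 = x2 /\ y1 = - y2).
  by case=> e1 e2; move: ne; rewrite {1}e1 {1}e2 !eqxx.
have sl := slopeP C1 C2 ne; rewrite (addP C1 C2 ne sl); apply/on_curveP.
exact: C_third sl.
Qed.

Lemma ec_opp_on P : on_curve P -> on_curve (ec_opp P).
Proof. by case: P => [[x y]|] //=; rewrite sqrrN. Qed.

Let slopeC x1 y1 x2 y2 m : is_slope x1 y1 x2 y2 m -> is_slope x2 y2 x1 y1 m.
Proof.
case=> e1 e2; split; first by rewrite -[LHS]opprB e1; ring.
by rewrite addrC e2; ring.
Qed.

Let Y3E x1 y1 x2 y2 m : is_slope x1 y1 x2 y2 m ->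
  Y3 m x2 y2 x1 = Y3 m x1 y1 x2.
Proof.
case=> e1 _; have -> : y2 = y1 + m * (x2 - x1) by rewrite -e1; ring.
rewrite /Y3 /X3; ring.
Qed.

Let dec (x1 y1 x2 y2 : F) :
  {x1 = x2 /\ y1 = - y2 :> F} + {~ (x1 = x2 /\ y1 = - y2 :> F)}.
Proof.
have [/andP[/eqP e1 /eqP e2]|ne] := boolP ((x1 == x2 :> F) && (y1 == - y2)).
  by left.
by right; case=> e1 e2; move: ne; rewrite {1}e1 {1}e2 !eqxx.
Qed.

Lemma ec_addC P Q : on_curve P -> on_curve Q -> ec_add P Q = ec_add Q P.
Proof.
case: P Q => [[x1 y1]|] [[x2 y2]|] // /on_curveP C1 /on_curveP C2.
have [[-> ->]|ne] := dec x1 y1 x2 y2.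
  by rewrite /= opprK !eqxx.
have ne' : ~ (x2 = x1 /\ y2 = - y1) by case=> e1 e2; apply: ne; rewrite e2 opprK.
have sl := slopeP C1 C2 ne; rewrite (addP C1 C2 ne sl).
rewrite (addP C2 C1 ne' (slopeC sl)) (Y3E sl); congr (Some (_, _)).
rewrite /X3; ring.
Qed.

Lemma ec_addN P : ec_add (ec_opp P) P = None.
Proof. by case: P => [[x y]|] //=; rewrite !eqxx. Qed.

Let C_opp x y : C x y -> C x (- y). Proof. by rewrite /C sqrrN. Qed.

Let ec_addr0 P : ec_add P None = P.
Proof. by case: P => [[]|]. Qed.

Let ec_addK P Q : on_curve P -> on_curve Q ->
  ec_add (ec_opp P) (ec_add P Q) = Q.
Proof.
move=> oP oQ; have := oP; have := oQ.
case: P Q oP oQ => [[x1 y1]|] [[x2 y2]|] oP oQ.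
- move=> /on_curveP C2 /on_curveP C1.
  have [[-> ->]|ne] := dec x1 y1 x2 y2.
    by rewrite [ec_add _ (Some _)]/= !eqxx /= opprK.
  have sl := slopeP C1 C2 ne; rewrite (addP C1 C2 ne sl).
  set m := ec_slope _ _ in sl *; have C3 := C_third C1 sl.
  have [e1 e2] := sl.
  have y2E : y2 = y1 + m * (x2 - x1) by rewrite -e1; ring.
  have bE :
      b = m * (y1 + y2) - c * (x1 ^+ 2 + x1 * x2 + x2 ^+ 2) - a * (x1 + x2).
    by rewrite e2; ring.
  have sl' : is_slope x1 (- y1) (X3 m x1 x2) (Y3 m x1 y1 x2) (- m).
    split; first by rewrite /Y3; ring.
    rewrite bE y2E /Y3 /X3; field; exact: c_neq0.
  have ne' : ~ (x1 = X3 m x1 x2 /\ - y1 = - Y3 m x1 y1 x2).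
    case=> ex /oppr_inj ey.
    have ey' : y1 = - y1 by rewrite {1}ey /Y3 -ex subrr mulr0 addr0.
    have y0 : y1 = 0.
      have /eqP : 2%:R * y1 = 0 by rewrite mulr_natl mulr2n {1}ey' addNr.
      by rewrite mulf_eq0 (negPf two_neq0) => /eqP.
    have f0 : f.[x1] = 0 by rewrite horner_cubic -C1 y0 expr0n.
    have /eqP[] := cubic_smooth f0; rewrite horner_deriv_cubic.
    case: sl' => _; rewrite -ex -ey y0 oppr0 addr0 mulr0 => e.
    rewrite [RHS]e; ring.
  rewrite [ec_opp _]/= (addP (C_opp C1) C3 ne' sl').
  have -> : X3 (- m) x1 (X3 m x1 x2) = x2 by rewrite /X3; ring.
  congr (Some (_, _)); rewrite /Y3.
  have -> : X3 (- m) x1 (X3 m x1 x2) = x2 by rewrite /X3; ring.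
  rewrite y2E; ring.
- by move=> _ _; rewrite /= !eqxx.
- by [].
- by [].
Qed.

Let ec_oppK P : ec_opp (ec_opp P) = P.
Proof. by case: P => [[x y]|] //=; rewrite opprK. Qed.

Let ec_addNK P Q : on_curve P -> on_curve Q ->
  ec_add P (ec_add (ec_opp P) Q) = Q.
Proof.
by move=> oP oQ; rewrite -{1}[P]ec_oppK ec_addK // ec_opp_on.
Qed.

Let ec_oppD P Q : on_curve P -> on_curve Q ->
  ec_opp (ec_add P Q) = ec_add (ec_opp P) (ec_opp Q).
Proof.
case: P Q => [[x1 y1]|] [[x2 y2]|] // /on_curveP C1 /on_curveP C2.
have [[-> ->]|ne] := dec x1 y1 x2 y2; first by rewrite /= opprK !eqxx.
have sl := slopeP C1 C2 ne; rewrite (addP C1 C2 ne sl).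
set m := ec_slope _ _ in sl *; rewrite [ec_opp (Some (x1, _))]/=.
have ne' : ~ (x1 = x2 /\ - y1 = - - y2).
  by case=> e1 e; apply: ne; split=> //; apply: oppr_inj.
have sl' : is_slope x1 (- y1) x2 (- y2) (- m).
  case: sl => e1 e2; split; last by rewrite -e2; ring.
  by rewrite mulNr -e1; ring.
rewrite [ec_opp (Some (x2, y2))]/= (addP (C_opp C1) (C_opp C2) ne' sl') /=.
congr (Some (_, _)); rewrite /Y3 /X3; ring.
Qed.

(* For collinear-free P, Q, R, let l, m be the slopes of PQ, QR.  The slopes
   of (P + Q)R and P(Q + R) are k - l and k - m for a common k. *)
Let slope_assoc x1 y1 x2 y2 x3 y3 l m : C x1 y1 ->
  is_slope x1 y1 x2 y2 l -> is_slope x2 y2 x3 y3 m ->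
  x1 != x3 -> l != m ->
  is_slope (X3 l x1 x2) (Y3 l x1 y1 x2) x3 y3 (c * (x1 - x3) / (l - m) - l).
Proof.
move=> C1 [e1 e2] [e3 e4] nx nl.
have nxz : x1 - x3 != 0 by rewrite subr_eq0.
have nlz : l - m != 0 by rewrite subr_eq0.
have y2E : y2 = y1 + l * (x2 - x1) by rewrite -e1; ring.
have y3E : y3 = y1 + l * (x2 - x1) + m * (x3 - x2).
  by rewrite -y2E -e3; ring.
have bE :
    b = l * (y1 + y2) - c * (x1 ^+ 2 + x1 * x2 + x2 ^+ 2) - a * (x1 + x2).
  by rewrite e2; ring.
have aE : a = (l * (y1 + y2) - m * (y2 + y3)) / (x1 - x3) - c * (x1 + x2 + x3).
  by apply: (mulIf nxz); rewrite mulrBl divfK // e2 e4; ring.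
split; last rewrite bE; rewrite /Y3 /X3 aE y3E y2E; field;
  by rewrite ?nlz ?nxz ?c_neq0.
Qed.

Lemma ec_addA P Q R : on_curve P -> on_curve Q -> on_curve R ->
  ec_add P (ec_add Q R) = ec_add (ec_add P Q) R.
Proof.
move=> oP oQ oR.
have [->|PR] := eqVneq P R.
  by rewrite ec_addC ?ec_add_on // (ec_addC oQ).
have [->|PQ] := eqVneq P (ec_opp Q).
  by rewrite ec_addK // ec_addN.
have [->|QR] := eqVneq Q (ec_opp R).
  rewrite ec_addN (@ec_addC _ R) ?ec_add_on ?ec_opp_on //.
  by rewrite (@ec_addC P (ec_opp R)) ?ec_opp_on // ec_addNK // ec_addr0.
have [eP|nPR] := eqVneq P (ec_opp R).
  rewrite eP (@ec_addC Q) // ec_addK // ec_addC ?ec_add_on ?ec_opp_on //.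
  by rewrite ec_addNK.
have [eR|PQR] := eqVneq (ec_opp (ec_add P Q)) R.
  have -> : ec_add Q R = ec_opp P.
    by rewrite -eR ec_oppD // (@ec_addC (ec_opp P)) ?ec_addNK ?ec_opp_on.
  rewrite -eR (@ec_addC P (ec_opp P)) ?ec_opp_on //.
  by rewrite (@ec_addC (ec_add P Q)) ?ec_opp_on ?ec_add_on // !ec_addN.
have [eP|QRP] := eqVneq (ec_opp (ec_add Q R)) P.
  have -> : ec_add P Q = ec_opp R.
    by rewrite -eP ec_oppD // ec_addC ?ec_addNK ?ec_add_on ?ec_opp_on.
  by rewrite -eP !ec_addN.
have [->|R0] := eqVneq R None; first by rewrite !ec_addr0.
case: P Q R oP oQ oR PR PQ QR nPR PQR QRP R0
  => [[x1 y1]|] [[x2 y2]|] [[x3 y3]|] //.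
move=> oP oQ oR; have := oR; have := oQ; have := oP.
move=> /on_curveP C1 /on_curveP C2 /on_curveP C3 PR PQ QR nPR PQR QRP _.
have ne12 : ~ (x1 = x2 /\ y1 = - y2).
  by case=> e1 e2; move: PQ; rewrite /= e1 e2 eqxx.
have ne23 : ~ (x2 = x3 /\ y2 = - y3).
  by case=> e1 e2; move: QR; rewrite /= e1 e2 eqxx.
have nx : x1 != x3.
  apply/eqP => e; rewrite -e in C3 PR nPR.
  case: (same_x C1 C3) => e'; first by rewrite e' eqxx in PR.
  by rewrite /= e' eqxx in nPR.
have sl := slopeP C1 C2 ne12; have sm := slopeP C2 C3 ne23.
move: PQR QRP; rewrite (addP C1 C2 ne12 sl) (addP C2 C3 ne23 sm).
set l := ec_slope _ _ in sl *; set m := ec_slope _ _ in sm *.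
move=> PQR QRP.
have ne4 : ~ (X3 l x1 x2 = x3 /\ Y3 l x1 y1 x2 = - y3).
  by case=> e1 e2; move: PQR; rewrite /= e1 e2 opprK eqxx.
have ne5 : ~ (x1 = X3 m x2 x3 /\ y1 = - Y3 m x2 y2 x3).
  by case=> e1 e2; move: QRP; rewrite /= -e1 -e2 eqxx.
have nl : l != m.
  apply/eqP => elm; apply: ne4.
  case: (sl) => e1 e2; case: (sm) => e3 e4; rewrite -elm in e3 e4.
  have nxz : x1 - x3 != 0 by rewrite subr_eq0.
  have y2E : y2 = y1 + l * (x2 - x1) by rewrite -e1; ring.
  have y3E : y3 = y1 + l * (x2 - x1) + l * (x3 - x2).
    by rewrite -y2E -e3; ring.
  have aE : a = l ^+ 2 - c * (x1 + x2 + x3).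
    apply: (mulIf nxz).
    have -> : a * (x1 - x3) = l * (y1 + y2) - l * (y2 + y3)
        - c * (x1 + x2 + x3) * (x1 - x3) by rewrite e2 e4; ring.
    rewrite y3E y2E; ring.
  have xE : X3 l x1 x2 = x3 by rewrite /X3 aE; field; exact: c_neq0.
  by split=> //; rewrite /Y3 xE y3E; ring.
have nlz : l - m != 0 by rewrite subr_eq0.
have s4 := slope_assoc C1 sl sm nx nl.
have nx' : x3 != x1 by rewrite eq_sym.
have nl' : m != l by rewrite eq_sym.
have := slope_assoc C3 (slopeC sm) (slopeC sl) nx' nl'.
rewrite (Y3E sm) => /slopeC s5.
have xE : X3 m x3 x2 = X3 m x2 x3 by rewrite /X3; ring.
rewrite xE in s5.
rewrite (addP (C_third C1 sl) C3 ne4 s4) (addP C1 (C_third C2 sm) ne5 s5).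
case: (sl) => e1 _; case: (sm) => e3 _.
have y2E : y2 = y1 + l * (x2 - x1) by rewrite -e1; ring.
have nlz' : m - l != 0 by rewrite subr_eq0.
have xx : X3 (c * (x3 - x1) / (m - l) - m) x1 (X3 m x2 x3) =
          X3 (c * (x1 - x3) / (l - m) - l) (X3 l x1 x2) x3.
  by rewrite /X3; field; rewrite ?nlz ?nlz' ?c_neq0.
congr (Some (_, _)); first exact: xx.
case: (sl) => _ e2; case: (sm) => _ e4.
have nxz : x1 - x3 != 0 by rewrite subr_eq0.
have y3E : y3 = y1 + l * (x2 - x1) + m * (x3 - x2).
  by rewrite -y2E -e3; ring.
have aE : a = (l * (y1 + y2) - m * (y2 + y3)) / (x1 - x3) - c * (x1 + x2 + x3).
  by apply: (mulIf nxz); rewrite mulrBl divfK // e2 e4; ring.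
rewrite /Y3 xx /X3 aE y3E y2E; field.
by rewrite ?nlz ?nlz' ?nxz ?c_neq0.
Qed.

End RawGroupLaw.

Record point (F : numFieldType) (E : ellcurve F) := Point {
  coords : option (F * F);
  coords_on : on_curve E coords
}.

Section PointGroup.

Variables (F : numFieldType) (E : ellcurve F).

HB.instance Definition _ := [isSub for @coords F E].
HB.instance Definition _ := [Choice of point E by <:].

Definition pt_zero : point E := @Point F E None isT.
Definition pt_opp (P : point E) := Point (ec_opp_on (coords_on P)).
Definition pt_add (P Q : point E) :=
  Point (ec_add_on (coords_on P) (coords_on Q)).

Fact pt_addA : associative pt_add.
Proof. by move=> P Q R; apply: val_inj; apply: ec_addA; apply: coords_on. Qed.

Fact pt_addC : commutative pt_add.
Proof. by move=> P Q; apply: val_inj; apply: ec_addC; apply: coords_on. Qed.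

Fact pt_add0 : left_id pt_zero pt_add.
Proof. by move=> P; apply: val_inj. Qed.

Fact pt_addN : left_inverse pt_zero pt_opp pt_add.
Proof. by move=> P; apply: val_inj; apply: ec_addN. Qed.

HB.instance Definition _ :=
  GRing.isZmodule.Build (point E) pt_addA pt_addC pt_add0 pt_addN.

End PointGroup.

Definition Zindependent (V : zmodType) (n : nat) (P : 'I_n -> V) : Prop :=
  forall m : 'I_n -> int, \sum_(i < n) P i *~ m i = 0 -> forall i, m i = 0.

(* The rank of an abelian group is the maximal number of Z-linearly independent
   elements, i.e. the dimension of its tensor product with Q. *)
Definition has_rank (V : zmodType) (r : nat) : Prop :=
  (exists P : 'I_r -> V, Zindependent P) /\
  (forall (n : nat) (P : 'I_n -> V), Zindependent P -> (n <= r)%N).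

(* Meant for p prime with p = 1 %[mod 4] and a a square prime to p. *)
Definition quartic_symbol (a p : nat) : int :=
  if [exists x : 'F_p, x ^+ 4 == a%:R] then 1 else -1.

Definition cubic_p (p : nat) : {poly rat} :=
  ('X - (p%:R)%:P) ^+ 3 + 'X ^+ 3 + ('X + (p%:R)%:P) ^+ 3.

Lemma cubic_pE p : cubic_p p = 3%:R *: 'X ^+ 3 + (6%:R * p%:R ^+ 2) *: 'X.
Proof. rewrite /cubic_p -!mul_polyC rmorphM rmorphXn /= !rmorph_nat; ring. Qed.

Lemma size_cubic_p p : size (cubic_p p) = 4%N.
Proof.
have h3 : size (3%:R *: 'X ^+ 3 : {poly rat}) = 4%N.
  by rewrite size_scale ?size_polyXn.
rewrite cubic_pE size_polyDl h3 //.
by apply: (leq_ltn_trans (size_scale_leq _ _)); rewrite size_polyX.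
Qed.

Lemma separable_cubic_p p : prime p -> separable_poly (cubic_p p).
Proof.
move=> p_pr; have p0 : p%:R != 0 :> rat by rewrite pnatr_eq0 -lt0n prime_gt0.
set q : rat := p%:R; rewrite unlock; apply/Bezout_coprimepP.
exists (- 9%:R * 'X, (4%:R * q ^+ 2)%:P + 3%:R * 'X ^+ 2).
have q4 : 24%:R * q ^+ 4 != 0 by rewrite mulf_neq0 ?expf_neq0.
suff -> : - 9%:R * 'X * cubic_p p
    + ((4%:R * q ^+ 2)%:P + 3%:R * 'X ^+ 2) * (cubic_p p)^`()
    = (24%:R * q ^+ 4)%:P by rewrite -size_poly_eq1 size_polyC q4.
rewrite cubic_pE -/q !derivE /= -!mul_polyC.
rewrite !(polyCM, polyC_exp, polyC_natr) mulr1; ring.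
Qed.

Definition E_ (p : nat) (p_pr : prime p) : ellcurve rat :=
  EllCurve (size_cubic_p p) (separable_cubic_p p_pr).

(* Main.v *)
(* Put B = 18 p^2.  In the coordinates x = 3 X, y = 3 Y the curve is
   y^2 = x^3 + B x, it has the 2-torsion point T = (0, 0), and a representation
   3 p = a^4 + 2 b^4 gives a point R with x(R) = 3 p (a / b)^2.

   Upper bound: modulo squares, the abscissa of a rational point is 1, 2, 3 p or
   6 p, and a positive abscissa on the 2-isogenous curve y^2 = x^3 - 4 B x is a
   square.  The other classes are excluded modulo 3, 4 and p, because 2 and -1
   are fourth powers modulo p while 3 is not a square.  Hence every point P is
   congruent to one of 0, T, R, R + T modulo doubles.  As doubling multiplies
   the logarithmic height by about 4 and adding R about doubles it at most, iterating
   P + e R + d T = 2 P1 stays in a finite set, so a multiple of P is a multiple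
   of R.

   Lower bound: doubles have nonzero square abscissas, while 3 p and 6 p are not
   squares and x(T) = 0, so no multiple of R vanishes. *)
Require Import Defs.
From mathcomp Require Import all_boot all_order all_algebra.
From mathcomp Require Import finfield ring zify.

Set Implicit Arguments.
Unset Strict Implicit.
Unset Printing Implicit Defensive.

Import Order.TTheory GRing.Theory Num.Theory.
Local Open Scope ring_scope.

(** * Squares and fourth powers modulo primes *)

Section Reduction.

Variables (q : nat) (q_pr : prime q).

Lemma prime_intr_Fp : q%:Z%:~R = 0 :> 'F_q.
Proof. by apply/eqP; rewrite -(dvdz_pcharf (pchar_Fp q_pr)) dvdzz. Qed.

Lemma intr_Fp_eq0 (n : int) : n%:~R = 0 :> 'F_q -> exists k, n = q%:Z * k.
Proof.
move/eqP; rewrite -(dvdz_pcharf (pchar_Fp q_pr)) => /dvdzP[k ->].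
by exists k; rewrite mulrC.
Qed.

Lemma coprimez_Fp (u e : int) :
  coprimez u e -> u%:~R = 0 :> 'F_q -> e%:~R = 0 :> 'F_q -> False.
Proof.
move=> cop /eqP; rewrite -(dvdz_pcharf (pchar_Fp q_pr)) => qu /eqP.
rewrite -(dvdz_pcharf (pchar_Fp q_pr)) => qe.
have : (q %| gcdz u e)%Z by rewrite dvdz_gcd qu.
by rewrite (eqP cop) dvdz1 absz_nat => /eqP q1; move: q_pr; rewrite q1.
Qed.

Lemma prime_lift_Fp (r : nat) : prime r -> r != q -> r%:Z%:~R != 0 :> 'F_q.
Proof.
move=> r_pr neq; rewrite -(dvdz_pcharf (pchar_Fp q_pr)).
by rewrite dvdzE !absz_nat dvdn_prime2 // eq_sym.
Qed.

End Reduction.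

(* A square root of -3 gives the cube root of unity (s - 1) / 2, which is trivial
   because 3 does not divide #|F| - 1. *)
Lemma card_mod3_neg3_nonsquare (F : finFieldType) (s : F) :
  #|F| = 2 %[mod 3] -> 2%:R != 0 :> F -> 3%:R != 0 :> F -> s ^+ 2 != - 3%:R.
Proof.
move=> cF n2 n3; apply/eqP => s2.
have n4 : 4%:R != 0 :> F by rewrite (natrM _ 2 2) mulf_neq0.
pose w : F := (s - 1) / 2%:R.
have w_root : w ^+ 2 + w + 1 = 0.
  have -> : w ^+ 2 + w + 1 = (s ^+ 2 + 3%:R) / 4%:R by rewrite /w; field; rewrite ?n4 ?n2.
  by rewrite s2 addNr mul0r.
have w3 : w ^+ 3 = 1.
  have -> : w ^+ 3 = (w - 1) * (w ^+ 2 + w + 1) + 1 by ring.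
  by rewrite w_root mulr0 add0r.
have w2 : w ^+ 2 = w.
  have := expf_card w; rewrite (divn_eq #|F| 3) cF exprD mulnC exprM w3 expr1n.
  by rewrite mul1r.
have w_neq0 : w != 0.
  by apply/eqP => w0; move: w3; rewrite w0 expr0n => /esym/eqP; rewrite oner_eq0.
have w1 : w = 1 by apply: (mulfI w_neq0); rewrite mulr1 -expr2.
have : 3%:R = 0 :> F by rewrite -w_root w1; ring.
by apply/eqP.
Qed.

Section ModP.

Variables (F : finFieldType) (h : F).
Hypotheses (cF : #|F| = 2 %[mod 3]) (n2 : 2%:R != 0 :> F) (n3 : 3%:R != 0 :> F).
Hypothesis h4 : h ^+ 4 = - 1.

(** Since [h ^+ 2] is a square root of -1, a nonzero [y] would make [h ^+ 2 * x / y] a square root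
    of -3. *)
Lemma sqr_eq_3sqr (x y : F) : x ^+ 2 = 3%:R * y ^+ 2 -> y = 0.
Proof.
move=> e; apply/eqP; apply: contraT => y0.
have /eqP[] := card_mod3_neg3_nonsquare (h ^+ 2 * x / y) cF n2 n3.
have -> : (h ^+ 2 * x / y) ^+ 2 = h ^+ 4 * x ^+ 2 / y ^+ 2 by field.
by rewrite h4 e; field.
Qed.

(** Each factor of [x ^+ 4 - 9 y ^+ 4] is handled by [sqr_eq_3sqr], the factor [x ^+ 2 + 3 y ^+ 2]
    after multiplying [x] by the square root [h ^+ 2] of -1. *)
Lemma quart_eq_9quart (x y : F) : x ^+ 4 = 9%:R * y ^+ 4 -> y = 0.
Proof.
move=> e; have /eqP : (x ^+ 2 - 3%:R * y ^+ 2) * (x ^+ 2 + 3%:R * y ^+ 2) = 0.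
  have -> : (x ^+ 2 - 3%:R * y ^+ 2) * (x ^+ 2 + 3%:R * y ^+ 2) =
    x ^+ 4 - 9%:R * y ^+ 4 by ring.
  by rewrite e subrr.
rewrite mulf_eq0 subr_eq0 => /orP[/eqP|]; first exact: sqr_eq_3sqr.
rewrite addr_eq0 => /eqP e'; apply: (@sqr_eq_3sqr (h ^+ 2 * x)).
by rewrite exprMn -exprM h4 e' mulN1r opprK.
Qed.

End ModP.

(** * Local obstructions for the two 2-isogeny torsors *)

Definition squarefree (d : nat) := forall q, prime q -> ~~ (q ^ 2 %| d)%N.

Lemma squarefree_div (d q : nat) : prime q -> squarefree d -> (q %| d)%N ->
  exists d', [/\ d = (q * d')%N, ~~ (q %| d')%N & squarefree d'].
Proof.
move=> q_pr sq /dvdnP[d' de]; exists d'; rewrite mulnC in de; split => //.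
  by apply/negP => qd'; have /negP[] := sq q q_pr; rewrite de dvdn_mul.
move=> r r_pr; apply/negP => rd'; have /negP[] := sq r r_pr.
by rewrite de dvdn_mull.
Qed.

Lemma squarefree_no_prime (d : nat) :
  squarefree d -> (forall q, prime q -> ~~ (q %| d)%N) -> d = 1%N.
Proof.
case: d => [|[|d]] // sq nq; first by have := sq 2%N isT.
by have := nq _ (pdiv_prime (isT : 1 < d.+2)%N); rewrite pdiv_dvd.
Qed.

(* If q did not divide c, it would divide W, then e, then W twice, and then u. *)
Lemma squarefree_prime_dvd (q d : nat) (W u e c : int) :
  prime q -> squarefree d -> coprimez u e ->
  W ^+ 2 = d%:Z * (d%:Z ^+ 2 * u ^+ 4 + c * e ^+ 4) -> (q %| d)%N ->
  c%:~R = 0 :> 'F_q.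
Proof.
move=> q_pr sq cop eW /(squarefree_div q_pr sq)[d' [de nd' _]].
apply/eqP; apply: contraT => c0.
have q0 : q%:Z != 0 by rewrite eqz_nat -lt0n prime_gt0.
have d0 : d'%:Z%:~R != 0 :> 'F_q by rewrite -(dvdz_pcharf (pchar_Fp q_pr)).
have toF (a b : int) : a = b -> a%:~R = b%:~R :> 'F_q by move=> ->.
have cq := prime_intr_Fp q_pr.
have sqr0 (a : int) b : a ^+ 2 = q%:Z * b -> exists k, a = q%:Z * k.
  move=> ab; apply: (intr_Fp_eq0 q_pr); apply/eqP; rewrite -sqrf_eq0 -rmorphXn.
  by rewrite ab rmorphM /= cq mul0r.
rewrite de PoszM in eW.
have [w eWw] : exists k, W = q%:Z * k.
  by apply: (sqr0 _ (d'%:Z * ((q%:Z * d'%:Z) ^+ 2 * u ^+ 4 + c * e ^+ 4)));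
    rewrite eW; ring.
have {}eW : q%:Z * w ^+ 2 = d'%:Z * ((q%:Z * d'%:Z) ^+ 2 * u ^+ 4 + c * e ^+ 4).
  by apply: (mulfI q0); rewrite mulrA -expr2 -exprMn -eWw eW; ring.
have e0 : e%:~R = 0 :> 'F_q.
  have := toF _ _ eW; rewrite !(rmorphXn, rmorphM, rmorphD, rmorph_nat) /= cq !mul0r.
  rewrite expr0n /= mul0r add0r => /esym/eqP.
  rewrite !mulf_eq0 (negPf d0) (negPf c0).
  by rewrite /= !orbb => /eqP.
have [e' ee] := intr_Fp_eq0 q_pr e0.
have [w' eww] : exists k, w = q%:Z * k.
  apply: (sqr0 _ (d'%:Z * (d'%:Z ^+ 2 * u ^+ 4 + q%:Z ^+ 2 * c * e' ^+ 4))).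
  by apply: (mulfI q0); rewrite eW ee; ring.
have : q%:Z * w' ^+ 2 = d'%:Z * (d'%:Z ^+ 2 * u ^+ 4 + q%:Z ^+ 2 * c * e' ^+ 4).
  apply: (mulfI q0); apply: (mulfI q0).
  have -> : q%:Z * (q%:Z * (q%:Z * w' ^+ 2)) = q%:Z * w ^+ 2 by rewrite eww; ring.
  by rewrite eW ee; ring.
move/toF; rewrite !(rmorphXn, rmorphM, rmorphD, rmorph_nat) /= cq expr0n /= !mul0r addr0.
move/esym/eqP; rewrite !mulf_eq0 (negPf d0) /= !orbb => /eqP u0.
by case: (coprimez_Fp q_pr cop u0 e0).
Qed.

Lemma int_parity (n : int) : exists k, n = 2%:Z * k \/ n = 2%:Z * k + 1.
Proof. by exists (n %/ 2)%Z; lia. Qed.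

Section Selmer.

Variables (p : nat) (p_pr : prime p) (p_mod : p = 17 %[mod 24]).
Variables (g h : 'F_p).
Hypotheses (g4 : g ^+ 4 = 2%:R) (h4 : h ^+ 4 = - 1).

Let p0 : p%:Z != 0. Proof. by rewrite eqz_nat -lt0n prime_gt0. Qed.
Let n2 : 2%:R != 0 :> 'F_p.
Proof. by apply: (@prime_lift_Fp p p_pr 2) => //; apply/eqP; lia. Qed.
Let n3 : 3%:R != 0 :> 'F_p.
Proof. by apply: (@prime_lift_Fp p p_pr 3) => //; apply/eqP; lia. Qed.
Let cF : #|'F_p| = 2 %[mod 3].
Proof. by rewrite card_Fp //; lia. Qed.
Let toF (a b : int) : a = b -> a%:~R = b%:~R :> 'F_p. Proof. by move=> ->. Qed.
Let cp : p%:Z%:~R = 0 :> 'F_p := prime_intr_Fp p_pr.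

Let only_prime2 (d : nat) : squarefree d ->
  (forall q, prime q -> (q %| d)%N -> q = 2%N) -> d = 1%N \/ d = 2%N.
Proof.
move=> sq only; have [e2|n2d] := boolP (2 %| d)%N; last first.
  left; apply: squarefree_no_prime => // q q_pr; apply/negP => qd.
  by move: n2d; rewrite -(only q q_pr qd) qd.
have [d' [de nd sq']] := squarefree_div (isT : prime 2) sq e2.
right; rewrite de (squarefree_no_prime sq') // => q q_pr; apply/negP => qd.
have eq : q = 2%N by apply: only => //; rewrite de dvdn_mull.
by rewrite -eq qd in nd.
Qed.

Let prime_coeff (k : int) (q : nat) : (forall r, prime r -> k%:~R = 0 :> 'F_r ->
  r = 2%N \/ r = 3%N) -> prime q -> (k * p%:Z ^+ 2)%:~R = 0 :> 'F_q ->
  [\/ q = 2%N, q = 3%N | q = p].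
Proof.
move=> hk q_pr /eqP; rewrite rmorphM rmorphXn /= mulf_eq0 expf_eq0 /=.
case/orP => [/eqP/(hk q q_pr)[]->|]; first by constructor 1.
  by constructor 2.
rewrite -(dvdz_pcharf (pchar_Fp q_pr)) dvdzE !absz_nat dvdn_prime2 //.
by move/eqP; constructor 3.
Qed.

(** [q] divides [W] twice, so [q ^ 4] divides [W ^+ 2]. When [q] divides [d] and [q ^ 2] divides the
    coefficient of [e ^+ 4], the torsor equation carries such a factor [q ^ 3]. *)
Let sqr_cube (q : nat) (W A : int) : prime q -> W ^+ 2 = q%:Z ^+ 3 * A ->
  exists w, A = q%:Z * w ^+ 2.
Proof.
move=> q_pr eW; have q0 : q%:Z != 0 by rewrite eqz_nat -lt0n prime_gt0.
have sqr0 (a : int) b : a ^+ 2 = q%:Z * b -> exists k, a = q%:Z * k.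
  move=> ab; apply: (intr_Fp_eq0 q_pr); apply/eqP; rewrite -sqrf_eq0 -rmorphXn.
  by rewrite ab rmorphM /= (prime_intr_Fp q_pr) mul0r.
have [w1 ew1] : exists k, W = q%:Z * k.
  by apply: (sqr0 _ (q%:Z ^+ 2 * A)); rewrite eW; ring.
have [w2 ew2] : exists k, w1 = q%:Z * k.
  apply: (sqr0 _ A); apply: (mulfI q0); apply: (mulfI q0).
  have -> : q%:Z * (q%:Z * w1 ^+ 2) = W ^+ 2 by rewrite ew1; ring.
  by rewrite eW; ring.
exists w2; do 3![apply: (mulfI q0)].
have -> : q%:Z * (q%:Z * (q%:Z * (q%:Z * w2 ^+ 2))) = W ^+ 2.
  by rewrite ew1 ew2; ring.
by rewrite eW; ring.
Qed.

(** Nonzero squares are 1 here and 8 is -1, so the equation makes two elements of {0, 1}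
    opposite. *)
Lemma F3_sqr_quart (a b x y : 'F_3) : a != 0 -> b != 0 ->
  a ^+ 2 * x ^+ 4 = 8%:R * b ^+ 2 * y ^+ 4 -> x = 0 /\ y = 0.
Proof.
have sqr1 (z : 'F_3) : z != 0 -> z ^+ 2 = 1.
  by case: z => [[|[|[|?]]] ?] // _; apply: val_inj.
move=> /sqr1-> /sqr1->; rewrite mul1r mulr1 !(exprM _ 2 2).
have [->|/sqr1->] := eqVneq x 0; have [->|/sqr1->] := eqVneq y 0 => //.
Qed.

(** This is the torsor of the positive class [d] on the isogenous curve [y^2 = x^3 - 72 p^2 x], with
    abscissa [d (u / e)^2]. Only 2, 3 and [p] can divide [d]; 3 is excluded modulo 3, [p] by fourth
    powers modulo [p], and 2 modulo 4. *)
Lemma dual_selmer (d : nat) (u e W : int) : squarefree d -> coprimez u e ->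
  W ^+ 2 = d%:Z * (d%:Z ^+ 2 * u ^+ 4 - 72%:R * p%:Z ^+ 2 * e ^+ 4) -> d = 1%N.
Proof.
move=> sq cop eW.
have primes_d q : prime q -> (q %| d)%N -> [\/ q = 2%N, q = 3%N | q = p].
  move=> q_pr qd; apply: (@prime_coeff (- 72%:R)) => //; last first.
    by apply: (squarefree_prime_dvd q_pr sq cop (W := W) _ qd); rewrite eW; ring.
  move=> r r_pr /eqP; rewrite -(dvdz_pcharf (pchar_Fp r_pr)) dvdzE !absz_nat.
  have -> : `|(- 72%:R : int)|%N = (2 ^ 3 * 3 ^ 2)%N by [].
  rewrite Euclid_dvdM // !Euclid_dvdX // !andbT !dvdn_prime2 //.
  by case/orP => /eqP; [left | right].
have n3d : ~~ (3 %| d)%N.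
  apply/negP => /(squarefree_div (isT : prime 3) sq)[d' [de nd' _]].
  have [w] : exists w,
      d'%:Z * (d'%:Z ^+ 2 * u ^+ 4 - 8%:R * p%:Z ^+ 2 * e ^+ 4) = 3%:Z * w ^+ 2.
    by apply: (@sqr_cube 3 W) => //; rewrite eW de PoszM; ring.
  move/(congr1 (fun a : int => a%:~R : 'F_3)).
  rewrite !(rmorphXn, rmorphM, rmorphB, rmorph_nat) /=.
  rewrite (prime_intr_Fp (isT : prime 3)) mul0r.
  have d0 : d'%:Z%:~R != 0 :> 'F_3.
    by rewrite -(dvdz_pcharf (pchar_Fp (isT : prime 3))).
  move/eqP; rewrite mulf_eq0 (negPf d0) subr_eq0 => /eqP.
  case/(F3_sqr_quart d0 (prime_lift_Fp (isT : prime 3) p_pr _)).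
    by apply/eqP; lia.
  exact: coprimez_Fp.
have npd : ~~ (p %| d)%N.
  apply/negP => /(squarefree_div p_pr sq)[d' [de nd' sq']].
  have [w] : exists w,
      d'%:Z * (d'%:Z ^+ 2 * u ^+ 4 - 72%:R * e ^+ 4) = p%:Z * w ^+ 2.
    by apply: (@sqr_cube p W) => //; rewrite eW de PoszM; ring.
  move/toF.
  rewrite !(rmorphXn, rmorphM, rmorphB, rmorph_nat) /= cp mul0r.
  have d0 : d'%:Z%:~R != 0 :> 'F_p by rewrite -(dvdz_pcharf (pchar_Fp p_pr)).
  move/eqP; rewrite mulf_eq0 (negPf d0) subr_eq0 => /eqP eF.
  (* Here [d'] is 1 or 2. As [4 = g ^+ 8] and [8 = g ^+ 12], the relation
     [d' ^+ 2 u ^+ 4 = 72 e ^+ 4] equates a fourth power with 9 times [(g ^+ 3 e) ^+ 4]. *)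
  have e0 : e%:~R = 0 :> 'F_p.
    have d'12 : d' = 1%N \/ d' = 2%N.
      apply: only_prime2 => // q q_pr qd'.
      have qd : (q %| d)%N by rewrite de dvdn_mull.
      case: (primes_d q q_pr qd) => // eq; last by rewrite -eq qd' in nd'.
      by rewrite -eq qd in n3d.
    have g0 : g != 0.
      by apply/eqP => g0; move: g4; rewrite g0 expr0n => /esym/eqP; apply/negP.
    have g12 : g ^+ 12 = 8%:R by rewrite (exprM g 4 3) g4; ring.
    have g8 : g ^+ 8 = 4%:R by rewrite (exprM g 4 2) g4; ring.
    suff /eqP : g ^+ 3 * e%:~R = 0 by rewrite mulf_eq0 expf_eq0 (negPf g0) => /eqP.
    case: d'12 => d'E; rewrite d'E -pmulrn in eF.
      apply: (quart_eq_9quart cF n2 n3 h4 (x := u%:~R)).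
      move: eF; rewrite expr1n mul1r => ->; rewrite exprMn -exprM g12; ring.
    apply: (quart_eq_9quart cF n2 n3 h4 (x := g ^+ 2 * u%:~R)).
    rewrite exprMn -exprM g8 exprMn -exprM g12; transitivity (72%:R * e%:~R ^+ 4 : 'F_p).
      by rewrite -eF; ring.
    by ring.
  apply: (coprimez_Fp p_pr cop) => //.
  move: eF; rewrite e0 expr0n mulr0 => /eqP; rewrite !mulf_eq0 (negPf d0) /= !orbb.
  by move/eqP.
have only2 q : prime q -> (q %| d)%N -> q = 2%N.
  move=> q_pr qd; case: (primes_d q q_pr qd) => // eq; move: qd; rewrite eq.
    by rewrite (negPf n3d).
  by rewrite (negPf npd).
case: (only_prime2 sq only2) => // d2; rewrite d2 in eW.
have [w ew] : exists w, u ^+ 4 - 18%:R * p%:Z ^+ 2 * e ^+ 4 = 2%:Z * w ^+ 2.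
  by apply: (@sqr_cube 2 W) => //; rewrite eW; ring.
have two_pr : prime 2 by [].
have u0 : u%:~R = 0 :> 'F_2.
  have /(congr1 (fun a : int => a%:~R : 'F_2)) :
    u ^+ 4 = 2%:Z * (w ^+ 2 + 9%:R * p%:Z ^+ 2 * e ^+ 4).
    transitivity (u ^+ 4 - 18%:R * p%:Z ^+ 2 * e ^+ 4
       + 18%:R * p%:Z ^+ 2 * e ^+ 4); first by ring.
    by rewrite ew; ring.
  rewrite rmorphXn rmorphM /= (prime_intr_Fp two_pr) mul0r => /eqP.
  by rewrite expf_eq0 => /eqP.
have [v ev] := intr_Fp_eq0 two_pr u0.
(* With [u = 2 v], two squares add up to a multiple of 8; the second one is odd, so the sum is 1 or
   2 modulo 4. *)
have eq8 : w ^+ 2 + (3%:R * p%:Z * e ^+ 2) ^+ 2 = 8%:R * v ^+ 4.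
  apply: (mulfI (isT : 2%:Z != 0)); rewrite mulrDr -ew ev; ring.
have [e' [ee|ee]] := int_parity e.
  by case: (coprimez_Fp two_pr cop u0);
    rewrite ee rmorphM /= (prime_intr_Fp two_pr) mul0r.
have [p' [ep|ep]] := int_parity p%:Z; first by clear -p_mod ep; lia.
have [z ez] : exists z, 3%:R * p%:Z * e ^+ 2 = 2%:Z * z + 1.
  rewrite ep ee.
  exists (3%:R * (2%:Z * p' + 1) * (2%:Z * e' ^+ 2 + 2%:Z * e') + 3%:R * p' + 1).
  by ring.
move: eq8; rewrite ez; have [k [->|->]] := int_parity w.
  have -> : (2 * k) ^+ 2 + (2 * z + 1) ^+ 2 = 2 * (2 * (k ^+ 2 + z ^+ 2 + z)) + 1 by ring.
  by move: (k ^+ 2 + z ^+ 2 + z) (v ^+ 4) => a b; clear; lia.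
have -> : (2 * k + 1) ^+ 2 + (2 * z + 1) ^+ 2 =
    4 * (k ^+ 2 + k + z ^+ 2 + z) + 2 by ring.
by move: (k ^+ 2 + k + z ^+ 2 + z) (v ^+ 4) => a b; clear; lia.
Qed.

(** This is the torsor of [d] on [y^2 = x^3 + 18 p^2 x]. Again only 2, 3 and [p] can divide [d], and
    the work modulo [p] shows that 3 and [p] divide [d] together or not at all. *)
Lemma primal_selmer (d : nat) (u e W : int) : squarefree d -> coprimez u e ->
  W ^+ 2 = d%:Z * (d%:Z ^+ 2 * u ^+ 4 + 18%:R * p%:Z ^+ 2 * e ^+ 4) ->
  [\/ d = 1, d = 2, d = 3 * p | d = 6 * p]%N.
Proof.
move=> sq cop eW.
have primes_d q : prime q -> (q %| d)%N -> [\/ q = 2%N, q = 3%N | q = p].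
  move=> q_pr qd; apply: (@prime_coeff 18%:R) => //; last first.
    exact: (squarefree_prime_dvd q_pr sq cop (W := W) _ qd).
  move=> r r_pr /eqP; rewrite -(dvdz_pcharf (pchar_Fp r_pr)) dvdzE.
  rewrite (_ : `|18%:R : int|%N = 2 * 3 ^ 2)%N // absz_nat Euclid_dvdM //.
  rewrite !Euclid_dvdX // !andbT !dvdn_prime2 //.
  by case/orP => /eqP; [left | right].
have g0 : g != 0.
  by apply/eqP => g0; move: g4; rewrite g0 expr0n => /esym/eqP; apply/negP.
have g8 : g ^+ 8 = 4%:R by rewrite (exprM g 4 2) g4; ring.
have [/(squarefree_div p_pr sq)[d' [de nd' sq']]|npd] := boolP (p %| d)%N.
  have [/(squarefree_div (isT : prime 3) sq')[d2 [d'e nd2 sq2]]|n3d] :=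
      boolP (3 %| d')%N.
    case: (only_prime2 sq2) => [q q_pr qd2||].
    - have qd' : (q %| d')%N by rewrite d'e dvdn_mull.
      have qd : (q %| d)%N by rewrite de dvdn_mull.
      case: (primes_d q q_pr qd) => // eq; last by rewrite -eq qd' in nd'.
      by rewrite -eq qd2 in nd2.
    - by move=> d21; constructor 3; rewrite de d'e d21 mulnC.
    - by move=> d22; constructor 4; rewrite de d'e d22 mulnC.
  have d'12 : d' = 1%N \/ d' = 2%N.
    apply: only_prime2 => // q q_pr qd'.
    have qd : (q %| d)%N by rewrite de dvdn_mull.
    case: (primes_d q q_pr qd) => // eq; last by rewrite -eq qd' in nd'.
    by rewrite -eq qd' in n3d.
  have [w] : exists w,
      d'%:Z * (d'%:Z ^+ 2 * u ^+ 4 + 18%:R * e ^+ 4) = p%:Z * w ^+ 2.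
    by apply: (@sqr_cube p W) => //; rewrite eW de PoszM; ring.
  move/toF; rewrite !(rmorphXn, rmorphM, rmorphD, rmorph_nat) /= cp mul0r.
  have d0 : d'%:Z%:~R != 0 :> 'F_p by rewrite -(dvdz_pcharf (pchar_Fp p_pr)).
  move/eqP; rewrite mulf_eq0 (negPf d0) addr_eq0 => /eqP eF.
  (* If [p] but not 3 divides [d], then [d' ^+ 2 u ^+ 4 = -18 e ^+ 4] modulo [p], and
     [-2 = (h g) ^+ 4] makes the right side 9 times [(h g e) ^+ 4]. *)
  have e0 : e%:~R = 0 :> 'F_p.
    suff /eqP : h * g * e%:~R = 0.
      rewrite !mulf_eq0 (negPf g0) orbF => /orP[/eqP h0|/eqP//].
      by move: h4 n2; rewrite h0 expr0n /= => /esym/eqP; rewrite oppr_eq0 oner_eq0.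
    case: d'12 => d'E; rewrite d'E -pmulrn in eF.
      apply: (quart_eq_9quart cF n2 n3 h4 (x := u%:~R)).
      by move: eF; rewrite expr1n mul1r => ->; rewrite !exprMn h4 g4; ring.
    apply: (quart_eq_9quart cF n2 n3 h4 (x := g ^+ 2 * u%:~R)).
    rewrite exprMn -exprM g8; transitivity (- (18%:R * e%:~R ^+ 4) : 'F_p).
      by rewrite -eF; ring.
    by rewrite !exprMn h4 g4; ring.
  case: (coprimez_Fp p_pr cop) => //.
  move: eF; rewrite e0 expr0n mulr0 oppr0 => /eqP; rewrite !mulf_eq0 (negPf d0) /= !orbb.
  by move/eqP.
have [/(squarefree_div (isT : prime 3) sq)[d' [de nd' sq']]|n3d] := boolP (3 %| d)%N;
  last first.
  case: (only_prime2 sq) => [q q_pr qd||].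
  - case: (primes_d q q_pr qd) => // eq; first by rewrite -eq qd in n3d.
    by rewrite -eq qd in npd.
  - by constructor 1.
  - by constructor 2.
have d'12 : d' = 1%N \/ d' = 2%N.
  apply: only_prime2 => // q q_pr qd'.
  have qd : (q %| d)%N by rewrite de dvdn_mull.
  case: (primes_d q q_pr qd) => // eq; first by rewrite -eq qd' in nd'.
  by rewrite -eq qd in npd.
have n6 : 6%:R != 0 :> 'F_p by rewrite (natrM _ 2 3) mulf_neq0.
(* If 3 but not [p] divides [d], then modulo [p] the square [W ^+ 2] is 3 times the square of
   [3 u ^+ 2] or of [6 g ^+ 2 u ^+ 2]. *)
have u0 : u%:~R = 0 :> 'F_p.
  have := toF eW; rewrite de PoszM.
  rewrite !(rmorphXn, rmorphM, rmorphD, rmorph_nat) /= cp expr0n /= mulr0 mul0r addr0.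
  case: d'12 => -> /=; rewrite -!pmulrn => eF.
    suff /eqP : 3%:R * u%:~R ^+ 2 = 0 :> 'F_p.
      by rewrite !mulf_eq0 (negPf n3) orbb => /eqP.
    by apply: (sqr_eq_3sqr cF n2 n3 h4 (x := W%:~R)); rewrite eF; ring.
  suff /eqP : 6%:R * g ^+ 2 * u%:~R ^+ 2 = 0 :> 'F_p.
    by rewrite !mulf_eq0 (negPf n6) (negPf g0) /= orbb => /eqP.
  apply: (sqr_eq_3sqr cF n2 n3 h4 (x := W%:~R)); rewrite eF.
  transitivity (108%:R * g ^+ 4 * u%:~R ^+ 4 : 'F_p); last by ring.
  by rewrite g4; ring.
have [v ev] := intr_Fp_eq0 p_pr u0.
have [w ew] : exists w, W = p%:Z * w.
  apply: (intr_Fp_eq0 p_pr); apply/eqP; rewrite -sqrf_eq0 -rmorphXn eW.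
  rewrite !(rmorphXn, rmorphM, rmorphD, rmorph_nat) /= cp u0.
  by rewrite !expr0n /= !(mulr0, mul0r, addr0).
(* Dividing by [p ^ 2] leaves [w ^+ 2 = 18 d e ^+ 4] modulo [p], again 3 times a square, so [p]
   would divide [e] too. *)
have : w ^+ 2 = d%:Z * (d%:Z ^+ 2 * p%:Z ^+ 2 * v ^+ 4 + 18%:R * e ^+ 4).
  do 2![apply: (mulfI p0)].
  have -> : p%:Z * (p%:Z * w ^+ 2) = W ^+ 2 by rewrite ew; ring.
  by rewrite eW ev; ring.
move/toF; rewrite de PoszM.
rewrite !(rmorphXn, rmorphM, rmorphD, rmorph_nat) /= cp.
rewrite expr0n /= mulr0 mul0r add0r => eF.
case: (coprimez_Fp p_pr cop u0); move: eF.
case: d'12 => -> /=; rewrite -!pmulrn => eF.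
  suff /eqP : 3%:R * g ^+ 2 * e%:~R ^+ 2 = 0 :> 'F_p.
    by rewrite !mulf_eq0 (negPf n3) (negPf g0) /= orbb => /eqP.
  apply: (sqr_eq_3sqr cF n2 n3 h4 (x := w%:~R)); rewrite eF.
  transitivity (27%:R * g ^+ 4 * e%:~R ^+ 4 : 'F_p); last by ring.
  by rewrite g4; ring.
suff /eqP : 6%:R * e%:~R ^+ 2 = 0 :> 'F_p.
  by rewrite !mulf_eq0 (negPf n6) orbb => /eqP.
by apply: (sqr_eq_3sqr cF n2 n3 h4 (x := w%:~R)); rewrite eF; ring.
Qed.

End Selmer.

(** * Square classes of abscissas *)

Lemma nat_squarefree_decomp (m : nat) : (0 < m)%N ->
  exists d s, [/\ squarefree d, (0 < s)%N & m = (d * s ^ 2)%N].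
Proof.
have [n] := ubnP m; elim: n m => // n IHn m; rewrite ltnS => le_mn m_gt0.
have [/existsP[q /andP[q_pr /dvdnP[m' em]]]|nex] :=
    boolP [exists q : 'I_m.+1, prime q && (q ^ 2 %| m)%N].
  have m'_gt0 : (0 < m')%N by case: m' em m_gt0 => // ->.
  have q_gt1 := prime_gt1 q_pr.
  have [|d [s [sq s_gt0 m'E]]] := IHn m' _ m'_gt0.
    apply: leq_trans le_mn; rewrite [X in (_ < X)%N]em -[X in (X < _)%N]muln1 ltn_pmul2l //.
    by rewrite -[X in (X < _)%N](exp1n 2) ltn_sqr.
  exists d, (s * q)%N; split=> //; first by rewrite muln_gt0 s_gt0 ltnW.
  by apply: (etrans em); rewrite m'E expnMn mulnA.
exists m, 1%N; split; rewrite ?muln1 // => q q_pr; apply/negP => qm.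
have lt_qm : (q < m.+1)%N.
  rewrite ltnS; apply: leq_trans (dvdn_leq m_gt0 qm).
  by rewrite -[X in (X <= _)%N]expn1 leq_exp2l // prime_gt1.
by move/existsP: nex; apply; exists (Ordinal lt_qm); rewrite q_pr.
Qed.

(** A fraction [m / n] has the square class of the integer [m n]. *)
Lemma rat_squarefree_decomp (x : rat) : 0 < x ->
  exists d (z : rat), [/\ squarefree d, z != 0 & x = d%:R * z ^+ 2].
Proof.
move=> x_gt0; have num_gt0 : (0 < `|numq x|)%N.
  by rewrite absz_gt0 numq_eq0 gt_eqF.
have den_gt0 : (0 < `|denq x|)%N by rewrite absz_gt0 denq_eq0.
have [|d [s [sq s_gt0 e]]] := @nat_squarefree_decomp (`|numq x| * `|denq x|).
  by rewrite muln_gt0 num_gt0.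
exists d, (s%:R / (denq x)%:~R); split=> //.
  by rewrite mulf_neq0 ?invr_eq0 ?intr_eq0 ?denq_eq0 // pnatr_eq0 -lt0n.
have den0 : (denq x)%:~R != 0 :> rat by rewrite intr_eq0 denq_eq0.
apply: (mulIf den0); apply: (mulIf den0).
rewrite -{1}[x]divq_num_den divfK //.
have nE : (numq x)%:~R = `|numq x|%N%:R :> rat.
  by rewrite natr_absz ger0_norm // numq_ge0 ltW.
have dE : (denq x)%:~R = `|denq x|%N%:R :> rat by rewrite natr_absz gtr0_norm.
transitivity ((`|numq x| * `|denq x|)%N%:R : rat); first by rewrite natrM nE -dE.
by rewrite e natrM natrX; field.
Qed.

Lemma rat_sqr_int (r : rat) (n : int) : r ^+ 2 = n%:~R -> exists m, r = m%:~R.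
Proof.
move=> e; have eZ : numq r ^+ 2 = n * denq r ^+ 2.
  apply: (@intr_inj rat); rewrite !(rmorphXn, rmorphM) /= -e numqE; ring.
have := coprime_num_den r; rewrite -(coprime_pexpl (k := 2)) //.
rewrite -(coprime_pexpr _ _ (k := 2)) // -!abszX eZ abszM coprimeMl.
rewrite /coprime gcdnn => /andP[_]; rewrite abszX -[X in _ == X](exp1n 2) eqn_sqr.
move=> /eqP den1; exists (numq r); rewrite -{1}[r]divq_num_den.
by rewrite -absz_denq den1 divr1.
Qed.

(* A point whose abscissa has class d modulo squares gives an integral point on
   the torsor of d. *)
Lemma class_torsor (c : int) (d : nat) (x y z : rat) :
  z != 0 -> x = d%:R * z ^+ 2 -> y ^+ 2 = x ^+ 3 + c%:~R * x ->
  exists W : int, W ^+ 2 =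
    d%:Z * (d%:Z ^+ 2 * numq z ^+ 4 + c * denq z ^+ 4).
Proof.
move=> z0 ex ey; have den0 : (denq z)%:~R != 0 :> rat by rewrite intr_eq0 denq_eq0.
pose n := d%:Z * (d%:Z ^+ 2 * numq z ^+ 4 + c * denq z ^+ 4).
have eW : (y / z * (denq z)%:~R ^+ 2) ^+ 2 = n%:~R.
  rewrite !(rmorphXn, rmorphM, rmorphD) /= numqE -!pmulrn !exprMn ey ex.
  by field.
have [W eW'] := rat_sqr_int eW; exists W; apply: (@intr_inj rat).
by rewrite rmorphXn /= -eW' eW.
Qed.

Section Classes.

Variables (p : nat) (p_pr : prime p) (p_mod : p = 17 %[mod 24]).
Variables (g h : 'F_p).
Hypotheses (g4 : g ^+ 4 = 2%:R) (h4 : h ^+ 4 = - 1).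

Lemma primal_class (x y : rat) : x != 0 ->
  y ^+ 2 = x ^+ 3 + 18%:R * p%:R ^+ 2 * x ->
  exists z, z != 0 /\ [\/ x = z ^+ 2, x = 2%:R * z ^+ 2,
    x = 3%:R * p%:R * z ^+ 2 | x = 6%:R * p%:R * z ^+ 2].
Proof.
(* The cofactor [x ^+ 2 + 18 p^2] is positive, so no negative square class occurs. *)
move=> x0 e; have x_gt0 : 0 < x.
  rewrite lt_neqAle eq_sym x0 /= leNgt; apply/negP => x_lt0.
  have: 0 <= y ^+ 2 by exact: sqr_ge0.
  have -> : y ^+ 2 = x * (x ^+ 2 + 18%:R * p%:R ^+ 2) by rewrite e; ring.
  have : 0 < x ^+ 2 + 18%:R * p%:R ^+ 2.
    apply: ltr_pwDl; first by rewrite exprn_even_gt0.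
    by apply: mulr_ge0; [exact: ler0n | exact: sqr_ge0].
  by move=> pos; rewrite (nmulr_rge0 _ x_lt0) leNgt pos.
have [d [z [sq z0 ex]]] := rat_squarefree_decomp x_gt0.
have e' : y ^+ 2 = x ^+ 3 + (18%:R * p%:Z ^+ 2)%:~R * x.
  by rewrite e rmorphM rmorphXn.
have [W eW] := class_torsor z0 ex e'.
exists z; split=> //; case: (primal_selmer p_pr p_mod g4 h4 sq _ eW) => [|dE|dE|dE|dE].
- by rewrite coprimezE coprime_num_den.
- by constructor 1; rewrite ex dE mul1r.
- by constructor 2; rewrite ex dE.
- by constructor 3; rewrite ex dE natrM.
- by constructor 4; rewrite ex dE natrM.
Qed.

(** Positive abscissas are settled by [dual_selmer]. Translation by the 2-torsion point [(0, 0)]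
    sends [x] to [- 72 p^2 / x], which makes a negative abscissa positive, and [72 p^2] is twice the
    square of [6 p]. *)
Lemma dual_class (x y : rat) : x != 0 ->
  y ^+ 2 = x ^+ 3 - 72%:R * p%:R ^+ 2 * x ->
  exists z, z != 0 /\ (x = z ^+ 2 \/ x = - (2%:R * z ^+ 2)).
Proof.
have pos (x' y' : rat) : 0 < x' -> y' ^+ 2 = x' ^+ 3 - 72%:R * p%:R ^+ 2 * x' ->
    exists2 z, z != 0 & x' = z ^+ 2.
  move=> x_gt0 e; have [d [z [sq z0 ex]]] := rat_squarefree_decomp x_gt0.
  have e' : y' ^+ 2 = x' ^+ 3 + (- (72%:R * p%:Z ^+ 2))%:~R * x'.
    rewrite e rmorphN /= rmorphM /= rmorphXn /= rmorph_nat.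
    by rewrite -pmulrn; ring.
  have [W eW] := class_torsor z0 ex e'.
  exists z => //; rewrite ex (dual_selmer p_pr p_mod g4 h4 sq (W := W)
    (u := numq z) (e := denq z)) ?mul1r //.
    by rewrite coprimezE coprime_num_den.
  by rewrite eW; ring.
move=> x0 e; have p0 : p%:R != 0 :> rat by rewrite pnatr_eq0 -lt0n prime_gt0.
have [x_gt0|x_lt0|] := ltrgt0P x; last by move/eqP; rewrite (negPf x0).
  by have [z z0 ->] := pos _ _ x_gt0 e; exists z; split=> //; left.
have N_gt0 : 0 < 72%:R * p%:R ^+ 2 :> rat.
  apply: mulr_gt0; first by rewrite ltr0n.
  by rewrite exprn_gt0 // ltr0n prime_gt0.
have [||z z0 ez] := pos (- (72%:R * p%:R ^+ 2 / x)) (72%:R * p%:R ^+ 2 * y / x ^+ 2).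
- by rewrite oppr_gt0 (pmulr_rlt0 _ N_gt0) invr_lt0.
- rewrite expr_div_n exprMn e; field; exact: x0.
exists (6%:R * p%:R / z); split; first by rewrite !mulf_neq0 ?invr_eq0.
right; have -> : x = - (72%:R * p%:R ^+ 2 / z ^+ 2) by rewrite -ez; field; rewrite ?x0 ?p0.
by field.
Qed.

End Classes.

(** * Heights *)

(** The multiplicative height is used, so that all estimates are inequalities between integers. *)
Definition height (x : rat) : int := Num.max `|numq x| (denq x).

Lemma num_le_height (x : rat) : `|numq x| <= height x.
Proof. by rewrite /height le_max lexx. Qed.

Lemma den_le_height (x : rat) : denq x <= height x.
Proof. by rewrite /height le_max lexx orbT. Qed.

Lemma height_ge1 (x : rat) : 1 <= height x.
Proof. by apply: le_trans (den_le_height x); rewrite -gtz0_ge1 denq_gt0. Qed.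

(** [k] is the factor lost in reducing the fraction; bounding it gives lower bounds for heights. *)
Lemma fraction_multiple (a d : int) : d != 0 ->
  exists k, [/\ k != 0, a = k * numq (a%:~R / d%:~R)
              & d = k * denq (a%:~R / d%:~R)].
Proof.
by move=> d0; case: divqP => [d_eq0|k x k0]; [rewrite d_eq0 in d0 | exists k].
Qed.

Lemma height_fraction (a d N : int) :
  d != 0 -> `|a| <= N -> `|d| <= N -> height (a%:~R / d%:~R) <= N.
Proof.
move=> d0; have [k [k0]] := fraction_multiple a d0.
set x : rat := _ / _ => -> ->; rewrite !normrM (gtr0_norm (denq_gt0 x)) => hn hd.
have k1 : 1 <= `|k| by rewrite -gtz0_ge1 normr_gt0.
rewrite /height ge_max; apply/andP; split.
  by apply: le_trans hn; rewrite ler_peMl.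
by apply: le_trans hd; rewrite ler_peMl.
Qed.

Lemma height_div (c : int) (x : rat) : 1 <= c -> x != 0 ->
  height (c%:~R / x) <= c * height x.
Proof.
move=> c1 x0; have num0 : numq x != 0 by rewrite numq_eq0.
have -> : c%:~R / x = (c * denq x)%:~R / (numq x)%:~R.
  rewrite -{1}[x]divq_num_den rmorphM /=; field.
  by rewrite !intr_eq0 num0 denq_eq0.
have c0 : 0 <= c by apply: le_trans c1.
have h0 : 0 <= height x by apply: le_trans (height_ge1 x).
apply: height_fraction => //.
  rewrite normrM (ger0_norm c0) (gtr0_norm (denq_gt0 x)).
  by rewrite ler_wpM2l // den_le_height.
by apply: le_trans (num_le_height x) _; rewrite ler_peMl.
Qed.

(** Bezout's identity for the cubes writes [c] as a combination of the two multiples. This bounds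
    the factor cancelled from a quotient of quadratic forms in [m] and [n], once combinations of
    these forms yield [c m ^+ 3] and [c n ^+ 3]. *)
Lemma coprime_cubes_dvd (k m n c : int) : coprimez m n ->
  (k %| c * m ^+ 3)%Z -> (k %| c * n ^+ 3)%Z -> (k %| c)%Z.
Proof.
move=> cop km kn; have : coprimez (m ^+ 3) (n ^+ 3).
  by rewrite coprimezXl // coprimezXr.
case/coprimezP => -[u v] /= e.
have -> : c = u * (c * m ^+ 3) + v * (c * n ^+ 3) by rewrite -[LHS]mulr1 -e; ring.
by apply: rpredD; apply: dvdz_mull.
Qed.

Lemma dvdz_norm_le (k c : int) : 0 < c -> (k %| c)%Z -> `|k| <= c.
Proof.
move=> c0 kc; rewrite -[c]gtr0_norm // -!abszE lez_nat.
by apply: dvdn_leq; rewrite -?dvdzE // absz_gt0 gt_eqF.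
Qed.

(** On [y^2 = x^3 + B x], the number [x + B / x = y^2 / x^2] is the abscissa of the image under the
    2-isogeny that kills [(0, 0)]. Its unreduced numerator is at least [height x ^+ 2], and the
    cancelled factor is at most [B]. *)
Lemma height_isogeny (B : int) (x : rat) : 1 <= B -> x != 0 ->
  height x ^+ 2 <= B * height (x + B%:~R / x).
Proof.
move=> B1 x0; set m := numq x; set n := denq x.
have m0 : m != 0 by rewrite numq_eq0.
have n0 : n != 0 by rewrite denq_eq0.
have -> : x + B%:~R / x = (m ^+ 2 + B * n ^+ 2)%:~R / (m * n)%:~R.
  rewrite -[x]divq_num_den -/m -/n rmorphD rmorphM !rmorphXn rmorphM /=; field.
  by rewrite !intr_eq0 m0 n0.
have [|k [k0]] := @fraction_multiple (m ^+ 2 + B * n ^+ 2) (m * n).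
  by rewrite mulf_neq0.
set x' : rat := _ / _ => eA eD.
have kB : `|k| <= B.
  apply: dvdz_norm_le; first by rewrite gtz0_ge1.
  apply: (@coprime_cubes_dvd _ m n).
  - by rewrite coprimezE coprime_num_den.
  - apply/dvdzP; exists (B * (m * numq x' - B * n * denq x')).
    transitivity (B * (m * (m ^+ 2 + B * n ^+ 2) - B * n * (m * n))); first by ring.
    by rewrite eA eD; ring.
  - apply/dvdzP; exists (n * numq x' - m * denq x').
    transitivity (n * (m ^+ 2 + B * n ^+ 2) - m * (m * n)); first by ring.
    by rewrite eA eD; ring.
have B0 : 0 <= B by apply: le_trans B1.
have sm : 0 <= m ^+ 2 by apply: sqr_ge0.
have sn : 0 <= n ^+ 2 by apply: sqr_ge0.
apply: (@le_trans _ _ (m ^+ 2 + B * n ^+ 2)).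
  have Bn : n ^+ 2 <= B * n ^+ 2 by rewrite ler_peMl.
  rewrite /height -/m -/n; case: (leP `|m| n) => _.
    by apply: le_trans Bn _; rewrite lerDr.
  by rewrite real_normK ?num_real // lerDl mulr_ge0.
have /ger0_norm <- : 0 <= m ^+ 2 + B * n ^+ 2 by rewrite addr_ge0 // mulr_ge0.
rewrite eA normrM.
by rewrite ler_pM // num_le_height.
Qed.

(** The quotient is the abscissa of the image under the dual 2-isogeny. The factor [16 B] bounds the
    cancellation. The numerator is a difference and may be small; [1 + B] comes from writing
    [(m^2 + 4 B n^2)^2] as its square plus [B] times the square of the denominator. *)
Lemma height_dual_isogeny (B : int) (x : rat) : 1 <= B -> x != 0 ->
  height x ^+ 2 <=
    16%:R * B * (1 + B) * height ((x ^+ 2 - 4%:R * B%:~R) / (4%:R * x)).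
Proof.
move=> B1 x0; set m := numq x; set n := denq x.
have m0 : m != 0 by rewrite numq_eq0.
have n0 : n != 0 by rewrite denq_eq0.
have -> : (x ^+ 2 - 4%:R * B%:~R) / (4%:R * x) =
    (m ^+ 2 - 4%:R * B * n ^+ 2)%:~R / (4%:R * m * n)%:~R.
  rewrite -[x]divq_num_den -/m -/n !(rmorphXn, rmorphM, rmorphB, rmorph_nat) /=; field.
  by rewrite !intr_eq0 m0 n0.
have [|k [k0]] := @fraction_multiple (m ^+ 2 - 4%:R * B * n ^+ 2) (4%:R * m * n).
  by rewrite !mulf_neq0.
set x' : rat := _ / _ => eA eD.
have B0 : 0 <= B by apply: le_trans B1.
have kB : `|k| <= 16%:R * B.
  apply: dvdz_norm_le; first by rewrite mulr_gt0 // gtz0_ge1.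
  apply: (@coprime_cubes_dvd _ m n).
  - by rewrite coprimezE coprime_num_den.
  - apply/dvdzP; exists (4%:R * B * (4%:R * m * numq x' + 4%:R * B * n * denq x')).
    transitivity (4%:R * B * (4%:R * m * (m ^+ 2 - 4%:R * B * n ^+ 2)
       + 4%:R * B * n * (4%:R * m * n))); first by ring.
    by rewrite eA eD; ring.
  - apply/dvdzP; exists (m * denq x' - 4%:R * n * numq x').
    transitivity (m * (4%:R * m * n) - 4%:R * n * (m ^+ 2 - 4%:R * B * n ^+ 2)).
      by ring.
    by rewrite eA eD; ring.
have sm : 0 <= m ^+ 2 by apply: sqr_ge0.
have sn : 0 <= n ^+ 2 by apply: sqr_ge0.
set M := 16%:R * B * height x'.
have h1 := height_ge1 x'; have h0 : 0 <= height x' by apply: le_trans h1.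
have M0 : 0 <= M by rewrite !mulr_ge0.
have AM : `|m ^+ 2 - 4%:R * B * n ^+ 2| <= M.
  by rewrite eA normrM ler_pM // num_le_height.
have DM : `|4%:R * m * n| <= M.
  by rewrite eD normrM ler_pM // gtr0_norm // den_le_height.
have Bn0 : 0 <= 4%:R * B * n ^+ 2 by apply: mulr_ge0 => //; apply: mulr_ge0.
apply: (@le_trans _ _ (m ^+ 2 + 4%:R * B * n ^+ 2)).
  have Bn : n ^+ 2 <= 4%:R * B * n ^+ 2.
    by apply: ler_peMl => //; apply: (le_trans B1); apply: ler_peMl.
  rewrite /height -/m -/n; case: (leP `|m| n) => _.
    by apply: le_trans Bn _; rewrite lerDr.
  by rewrite real_normK ?num_real // lerDl.
have -> : 16%:R * B * (1 + B) * height x' = (1 + B) * M by rewrite /M; ring.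
have B10 : 0 <= 1 + B by rewrite addr_ge0.
have s0 : 0 <= m ^+ 2 + 4%:R * B * n ^+ 2 by rewrite addr_ge0.
rewrite -(@ler_pXn2r _ 2) ?nnegrE ?(mulr_ge0 B10 M0) //.
have -> : (m ^+ 2 + 4%:R * B * n ^+ 2) ^+ 2 =
  (m ^+ 2 - 4%:R * B * n ^+ 2) ^+ 2 + B * (4%:R * m * n) ^+ 2 by ring.
apply: (@le_trans _ _ ((1 + B) * M ^+ 2)).
  have sqr_le t : `|t| <= M -> t ^+ 2 <= M ^+ 2.
    by move=> tM; rewrite -(real_normK (num_real t)) lerXn2r ?nnegrE.
  have -> : (1 + B) * M ^+ 2 = M ^+ 2 + B * M ^+ 2 by ring.
  by apply: lerD; [|apply: ler_wpM2l => //]; apply: sqr_le.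
have -> : ((1 + B) * M) ^+ 2 = (1 + B) * (1 + B) * M ^+ 2 by ring.
apply: ler_wpM2r; first exact: sqr_ge0.
by apply: ler_peMl => //; rewrite lerDl.
Qed.

(** For [x = m / n], the square of [y n ^+ 2] is the integer [m n (m ^+ 2 + B n ^+ 2)], which gives
    both integrality and the bound. *)
Lemma ordinate_numerator (B : int) (x y : rat) : 1 <= B ->
  y ^+ 2 = x ^+ 3 + B%:~R * x ->
  exists k, y * (denq x)%:~R ^+ 2 = k%:~R /\ `|k| <= (1 + B) * height x ^+ 2.
Proof.
move=> B1 e; set m := numq x; set n := denq x; set H := height x.
have B0 : 0 <= B by apply: le_trans B1.
have n0 : n%:~R != 0 :> rat by rewrite intr_eq0 denq_eq0.
have eQ : (y * n%:~R ^+ 2) ^+ 2 = (m * n * (m ^+ 2 + B * n ^+ 2))%:~R.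
  rewrite exprMn e -{1 2}[x]divq_num_den -/m -/n.
  by rewrite !(rmorphXn, rmorphM, rmorphD) /=; field.
have [k ek] := rat_sqr_int eQ; exists k; split=> //.
have eZ : k ^+ 2 = m * n * (m ^+ 2 + B * n ^+ 2).
  by apply: (@intr_inj rat); rewrite rmorphXn /= -ek eQ.
have H1 : 1 <= H by apply: height_ge1.
have H0 : 0 <= H by apply: le_trans H1.
have mH : `|m| <= H by apply: num_le_height.
have nH : `|n| <= H by rewrite gtr0_norm ?denq_gt0 // den_le_height.
have B10 : 0 <= 1 + B by rewrite addr_ge0.
have sqr_le t : `|t| <= H -> t ^+ 2 <= H ^+ 2.
  by move=> tH; rewrite -(real_normK (num_real t)) lerXn2r ?nnegrE.
have R0 : 0 <= (1 + B) * H ^+ 2 by apply: mulr_ge0 => //; exact: sqr_ge0.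
rewrite -(@ler_pXn2r _ 2) ?nnegrE // real_normK ?num_real // eZ.
have mn : m * n <= H ^+ 2.
  apply: le_trans (ler_norm _) _; rewrite normrM expr2.
  by apply: ler_pM.
have q : m ^+ 2 + B * n ^+ 2 <= (1 + B) * H ^+ 2.
  have -> : (1 + B) * H ^+ 2 = H ^+ 2 + B * H ^+ 2 by ring.
  by apply: lerD; [|apply: ler_wpM2l => //]; apply: sqr_le.
have q0 : 0 <= m ^+ 2 + B * n ^+ 2.
  by apply: addr_ge0; [|apply: mulr_ge0 => //]; exact: sqr_ge0.
apply: (@le_trans _ _ (H ^+ 2 * ((1 + B) * H ^+ 2))).
  apply: (@le_trans _ _ (H ^+ 2 * (m ^+ 2 + B * n ^+ 2))).
    by apply: ler_wpM2r.
  by apply: ler_wpM2l => //; exact: sqr_ge0.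
have -> : ((1 + B) * H ^+ 2) ^+ 2 = (1 + B) * (H ^+ 2 * ((1 + B) * H ^+ 2)) by ring.
apply: ler_peMl; last by rewrite lerDl.
by apply: mulr_ge0 => //; exact: sqr_ge0.
Qed.

(** The curve equations eliminate the cubic terms: apart from [y * y'], the numerator has degree 2
    in [x]. This is why adding a fixed point at most squares the height, up to a constant. *)
Lemma chord_abscissa (B x y x' y' : rat) : x != x' ->
  y ^+ 2 = x ^+ 3 + B * x -> y' ^+ 2 = x' ^+ 3 + B * x' ->
  ((y' - y) / (x' - x)) ^+ 2 - x - x' =
  ((x * x' + B) * (x + x') - 2%:R * y * y') / (x - x') ^+ 2.
Proof.
move=> ne e e'; have nz : x' - x != 0 by rewrite subr_eq0 eq_sym.
have nz' : x - x' != 0 by rewrite subr_eq0.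
rewrite expr_div_n.
have -> : (y' - y) ^+ 2 = x ^+ 3 + B * x + (x' ^+ 3 + B * x') - 2%:R * y * y'.
  by rewrite -e -e'; ring.
by field; rewrite nz nz'.
Qed.

Lemma height_add (B : int) (x' y' : rat) : 1 <= B ->
  y' ^+ 2 = x' ^+ 3 + B%:~R * x' ->
  exists C, forall x y, y ^+ 2 = x ^+ 3 + B%:~R * x -> x != x' ->
    height (((y' - y) / (x' - x)) ^+ 2 - x - x') <= C * height x ^+ 2.
Proof.
move=> B1 e'; have [k' [ek' _]] := ordinate_numerator B1 e'.
set m' := numq x'; set n' := denq x'.
have B0 : 0 <= B by apply: le_trans B1.
have n'0 : n'%:~R != 0 :> rat by rewrite intr_eq0 denq_eq0.
(* In units of [height x ^+ 2], [C1] bounds the numerator and [C2] the denominator of the chord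
   abscissa; both depend on [B] and the fixed point only. *)
pose C1 := (`|m'| + B * `|n'|) * (`|n'| + `|m'|) + 2%:R * (1 + B) * `|k'|.
pose C2 := (`|n'| + `|m'|) ^+ 2.
have C10 : 0 <= C1.
  apply: addr_ge0; last by apply: mulr_ge0 => //; apply: mulr_ge0 => //; apply: addr_ge0.
  by apply: mulr_ge0; apply: addr_ge0 => //; apply: mulr_ge0.
have C20 : 0 <= C2 by exact: sqr_ge0.
exists (C1 + C2) => x y e ne; rewrite (chord_abscissa ne e e').
have [k [ek kle]] := ordinate_numerator B1 e.
set H := height x in kle *; set m := numq x; set n := denq x.
have H0 : 0 <= H by apply: le_trans (height_ge1 x).
have n0 : n%:~R != 0 :> rat by rewrite intr_eq0 denq_eq0.
have mH : `|m| <= H by apply: num_le_height.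
have nH : `|n| <= H by rewrite gtr0_norm ?denq_gt0 // den_le_height.
have xE : x = m%:~R / n%:~R by rewrite divq_num_den.
have x'E : x' = m'%:~R / n'%:~R by rewrite divq_num_den.
have yE : y = k%:~R / n%:~R ^+ 2 by rewrite -ek mulfK // expf_neq0.
have y'E : y' = k'%:~R / n'%:~R ^+ 2 by rewrite -ek' mulfK // expf_neq0.
have D0 : m * n' - m' * n != 0.
  rewrite -(intr_eq0 rat) rmorphB !rmorphM /=.
  have -> : m%:~R * n'%:~R - m'%:~R * n%:~R = (x - x') * n%:~R * n'%:~R.
    by rewrite xE x'E; field; rewrite n0 n'0.
  by rewrite !mulf_neq0 // subr_eq0.
have -> : ((x * x' + B%:~R) * (x + x') - 2%:R * y * y') / (x - x') ^+ 2 =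
   ((m * m' + B * n * n') * (m * n' + m' * n) - 2%:R * k * k')%:~R /
   ((m * n' - m' * n) ^+ 2)%:~R.
  have D0' : m%:~R * n'%:~R - m'%:~R * n%:~R != 0 :> rat.
    by rewrite -!rmorphM -rmorphB intr_eq0.
  rewrite xE x'E yE y'E !(rmorphXn, rmorphM, rmorphD, rmorphB, rmorph_nat) /=.
  by field; rewrite n0 n'0 D0'.
have hD : `|m * n' - m' * n| <= H * (`|n'| + `|m'|).
  apply: le_trans (ler_normB _ _) _; rewrite !normrM mulrDr (mulrC `|m'|).
  by apply: lerD; apply: ler_wpM2r.
have hS : `|m * n' + m' * n| <= H * (`|n'| + `|m'|).
  apply: le_trans (ler_normD _ _) _; rewrite !normrM mulrDr (mulrC `|m'|).
  by apply: lerD; apply: ler_wpM2r.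
have hP : `|m * m' + B * n * n'| <= H * (`|m'| + B * `|n'|).
  apply: le_trans (ler_normD _ _) _; rewrite !normrM mulrDr mulrA (mulrC H B).
  rewrite (ger0_norm B0); apply: lerD; first by apply: ler_wpM2r.
  by apply: ler_wpM2r => //; apply: ler_wpM2l.
have Hsq : 0 <= H ^+ 2 by exact: sqr_ge0.
apply: height_fraction; first by rewrite expf_neq0.
  apply: (@le_trans _ _ (C1 * H ^+ 2)); last by apply: ler_wpM2r => //; rewrite lerDl.
  apply: le_trans (ler_normB _ _) _.
  have -> : C1 * H ^+ 2 = H * (`|m'| + B * `|n'|) * (H * (`|n'| + `|m'|)) +
     2%:R * ((1 + B) * H ^+ 2) * `|k'| by rewrite /C1; ring.
  rewrite !normrM; apply: lerD; first by apply: ler_pM.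
  by apply: ler_wpM2r => //; apply: ler_wpM2l.
apply: (@le_trans _ _ (C2 * H ^+ 2)); last by apply: ler_wpM2r => //; rewrite lerDr.
rewrite normrX; have -> : C2 * H ^+ 2 = (H * (`|n'| + `|m'|)) ^+ 2 by rewrite /C2; ring.
by rewrite lerXn2r ?nnegrE // mulr_ge0 // addr_ge0.
Qed.

(** * Division by 2 *)

(* The preimages of (s^2, s t) under the two 2-isogenies whose composition is
   multiplication by 2 have abscissas r^2 and r (r + 2 s) / 2. *)
Lemma halving_point (B : int) (s t r : rat) : 1 <= B -> s != 0 -> r != 0 ->
  t ^+ 2 = s ^+ 4 + B%:~R -> r ^+ 2 = 2%:R * (s ^+ 2 + t) ->
  exists u v, let l := (3%:R * u ^+ 2 + B%:~R) / (2%:R * v) in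
    [/\ v != 0, v ^+ 2 = u ^+ 3 + B%:~R * u, s ^+ 2 = l ^+ 2 - u - u,
        s * t = - (v + l * (s ^+ 2 - u))
      & height u ^+ 4 <= 16%:R * B ^+ 3 * (1 + B) * height (s ^+ 2)].
Proof.
move=> B1 s0 r0 et er; set b : rat := B%:~R.
have tE : t = r ^+ 2 / 2%:R - s ^+ 2 by rewrite er; field.
have bE : b = r ^+ 4 / 4%:R - r ^+ 2 * s ^+ 2.
  have -> : b = t ^+ 2 - s ^+ 4 by rewrite et; ring.
  by rewrite tE; field.
have b0 : b != 0 by rewrite intr_eq0 gt_eqF // gtz0_ge1.
have w0 : r + 2%:R * s != 0.
  apply: contraNneq b0 => /eqP; rewrite addr_eq0 => /eqP rE.
  by apply/eqP; rewrite bE rE; field.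
(* [u] is a root of [u + b / u = r ^+ 2], whose discriminant [r ^+ 4 - 4 b] is [(2 r s) ^+ 2]; the
   isogeny then requires [(v / u) ^+ 2 = r ^+ 2]. *)
pose u := r * (r + 2%:R * s) / 2%:R; pose v := r * u.
have u0 : u != 0 by rewrite !mulf_neq0.
have v0 : v != 0 by rewrite mulf_neq0.
have lE : (3%:R * u ^+ 2 + b) / (2%:R * v) = r + s.
  by rewrite bE /v /u; field; rewrite r0 w0.
have uE : u + b / u = r ^+ 2 by rewrite bE /u; field; rewrite r0 w0.
have sE : ((r ^+ 2) ^+ 2 - 4%:R * b) / (4%:R * r ^+ 2) = s ^+ 2.
  by rewrite bE; field.
exists u, v => /=; rewrite -/b lE; split=> //.
- by rewrite bE /v /u; field.
- by rewrite /u; field.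
- by rewrite tE /v /u; field.
have := height_isogeny B1 u0; rewrite -/b uE => h1.
have := @height_dual_isogeny B (r ^+ 2) B1; rewrite -/b sE => h2.
have B0 : 0 <= B by apply: le_trans B1.
have hr : 0 <= height (r ^+ 2) by apply: le_trans (height_ge1 _).
have {}h1 : height u ^+ 4 <= (B * height (r ^+ 2)) ^+ 2.
  by rewrite (exprM _ 2 2) lerXn2r ?nnegrE ?sqr_ge0 // mulr_ge0.
apply: (le_trans h1); rewrite exprMn.
have -> : 16%:R * B ^+ 3 * (1 + B) * height (s ^+ 2) =
  B ^+ 2 * (16%:R * B * (1 + B) * height (s ^+ 2)) by ring.
apply: ler_wpM2l; first exact: sqr_ge0.
by apply: h2; rewrite expf_neq0.
Qed.

Definition cubic_coef (p : nat) : int := 18%:R * p%:Z ^+ 2.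

Section Halving.

Variables (p : nat) (p_pr : prime p) (p_mod : p = 17 %[mod 24]).
Variables (g h : 'F_p).
Hypotheses (g4 : g ^+ 4 = 2%:R) (h4 : h ^+ 4 = - 1).

Local Notation B := (cubic_coef p).

Lemma coef_ge1 : 1 <= B.
Proof.
rewrite /cubic_coef -gtz0_ge1; apply: mulr_gt0 => //; apply: exprn_gt0.
by rewrite ltz_nat prime_gt0.
Qed.

Lemma coefE : B%:~R = 18%:R * p%:R ^+ 2 :> rat.
Proof. by rewrite /cubic_coef rmorphM /= rmorphXn /= rmorph_nat -pmulrn. Qed.

(** With [y = s t], the preimages of the point under the dual isogeny have abscissas [2 (s^2 + t)]
    and [2 (s^2 - t)], of product [- 72 p^2]. By [dual_class] the first is a square or minus twice a
    square; in the latter case the second is a square, and it is reached by changing the signs of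
    [s] and [t]. *)
Lemma halving (s y : rat) : s != 0 ->
  y ^+ 2 = (s ^+ 2) ^+ 3 + B%:~R * s ^+ 2 ->
  exists u v, let l := (3%:R * u ^+ 2 + B%:~R) / (2%:R * v) in
    [/\ v != 0, v ^+ 2 = u ^+ 3 + B%:~R * u, s ^+ 2 = l ^+ 2 - u - u,
        y = - (v + l * (s ^+ 2 - u))
      & height u ^+ 4 <= 16%:R * B ^+ 3 * (1 + B) * height (s ^+ 2)].
Proof.
move=> s0 ey; pose t := y / s; have yE : y = s * t by rewrite /t mulrC divfK.
have et : t ^+ 2 = s ^+ 4 + B%:~R by rewrite /t expr_div_n ey; field.
have p0 : p%:R != 0 :> rat by rewrite pnatr_eq0 -lt0n prime_gt0.
have b0 : B%:~R != 0 :> rat by rewrite intr_eq0 gt_eqF // gtz0_ge1 coef_ge1.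
have prod : (s ^+ 2 + t) * (s ^+ 2 - t) = - B%:~R.
  have -> : B%:~R = t ^+ 2 - s ^+ 4 by rewrite et; ring.
  by ring.
have X0 : 2%:R * (s ^+ 2 + t) != 0.
  rewrite mulf_neq0 //; apply: contraNneq b0 => w0.
  by rewrite -oppr_eq0 -prod w0 mul0r.
have [] := dual_class p_pr p_mod g4 h4 X0 (y := 2%:R * s * (2%:R * (s ^+ 2 + t))).
  have -> : 72%:R * p%:R ^+ 2 = 4%:R * (t ^+ 2 - s ^+ 4).
    by rewrite et coefE; ring.
  by ring.
move=> z [z0 [ez|ez]].
  by rewrite yE; apply: (halving_point coef_ge1 s0 z0 et); rewrite ez.
have -> : s ^+ 2 = (- s) ^+ 2 by ring.
have -> : y = (- s) * (- t) by rewrite yE; ring.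
apply: (halving_point (r := 6%:R * p%:R / z) coef_ge1).
- by rewrite oppr_eq0.
- by rewrite !mulf_neq0 ?invr_eq0.
- have -> : (- s) ^+ 4 = s ^+ 4 by ring.
  by rewrite -et; ring.
have w0 : s ^+ 2 + t != 0 by apply: contraNneq X0 => ->; rewrite mulr0.
have z2 : z ^+ 2 = - (s ^+ 2 + t).
  by apply: (mulfI (_ : 2%:R != 0)) => //; apply: oppr_inj; rewrite -ez; ring.
have -> : (- s) ^+ 2 + - t = - B%:~R / (s ^+ 2 + t).
  by rewrite -prod; field.
by rewrite expr_div_n z2 coefE; field; rewrite w0.
Qed.

End Halving.

(** * The group of rational points *)

Section Points.

Variables (p : nat) (p_pr : prime p).
Local Notation E := (E_ p_pr).

Local Notation B := (cubic_coef p).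

(* Coordinates for the model y^2 = x^3 + 18 p^2 x, with x = 3 X, y = 3 Y. *)
Definition at_pt (P : point E) (x y : rat) :=
  coords P = Some (x / 3%:R, y / 3%:R).

Lemma horner_cubic_p (X : rat) :
  (cubic_p p).[X] = 3%:R * X ^+ 3 + 6%:R * p%:R ^+ 2 * X.
Proof. by rewrite cubic_pE hornerD !hornerZ hornerXn hornerX. Qed.

Lemma horner_deriv_cubic_p (X : rat) :
  (cubic_p p)^`().[X] = 9%:R * X ^+ 2 + 6%:R * p%:R ^+ 2.
Proof.
rewrite cubic_pE derivD !derivZ derivXn derivX hornerD !hornerZ hornerMn /=.
by rewrite hornerXn hornerC; ring. Qed.

Lemma cubic_p2 : (cubic_p p)`_2 = 0.
Proof. by rewrite cubic_pE coefD !coefZ coefXn coefX !mulr0 addr0. Qed.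

Lemma cubic_p3 : (cubic_p p)`_3 = 3%:R.
Proof. by rewrite cubic_pE coefD !coefZ coefXn coefX !mulr0 addr0 mulr1. Qed.

Lemma curve_eqE (x y : rat) :
  ((y / 3%:R) ^+ 2 == (cubic_p p).[x / 3%:R])
  = (y ^+ 2 == x ^+ 3 + B%:~R * x).
Proof.
rewrite horner_cubic_p coefE -(inj_eq (mulfI (_ : 9%:R != 0))) //.
by congr (_ == _); field.
Qed.

Lemma at_curve P x y : at_pt P x y -> y ^+ 2 = x ^+ 3 + B%:~R * x.
Proof.
case: P => c oc; rewrite /at_pt /= => e; move: oc; rewrite e /= curve_eqE.
by move/eqP.
Qed.

Lemma at_exists (x y : rat) : y ^+ 2 = x ^+ 3 + B%:~R * x -> exists P, at_pt P x y.
Proof.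
move=> e; have oc : on_curve E (Some (x / 3%:R, y / 3%:R)).
  by rewrite /= curve_eqE e.
by exists (Point oc).
Qed.

Lemma at_ptP (P : point E) : P = 0 \/ exists x y, at_pt P x y.
Proof.
case eP: (coords P) => [[X Y]|]; last by left; apply: val_inj.
right; exists (3%:R * X), (3%:R * Y).
by rewrite /at_pt eP; congr (Some (_, _)); field.
Qed.

Lemma at_inj P Q x y : at_pt P x y -> at_pt Q x y -> P = Q.
Proof. by rewrite /at_pt => eP eQ; apply: val_inj; rewrite /= eP eQ. Qed.

Lemma at_uniq P x y x' y' : at_pt P x y -> at_pt P x' y' -> x = x' /\ y = y'.
Proof.
by rewrite /at_pt => -> [/mulIf ex /mulIf ey]; rewrite ex ?ey.
Qed.

Lemma at_not0 P x y : at_pt P x y -> P != 0.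
Proof. by move=> eP; apply: contra_eqN eP => /eqP ->. Qed.

Lemma at_opp P x y : at_pt P x y -> at_pt (- P) x (- y).
Proof.
by rewrite /at_pt => eP; rewrite /= eP /= mulNr.
Qed.

(** Scaling both coordinates by 3 preserves slopes and absorbs the leading coefficient 3 of the
    cubic. *)
Lemma at_add P Q x y x' y' : at_pt P x y -> at_pt Q x' y' -> x != x' ->
  let l := (y' - y) / (x' - x) in let x'' := l ^+ 2 - x - x' in
  at_pt (P + Q) x'' (- (y + l * (x'' - x))).
Proof.
move=> + + ne l x''; rewrite /at_pt /= => -> ->.
have neX : x / 3%:R != x' / 3%:R by rewrite (inj_eq (mulIf _)).
rewrite /= (negPf neX) /= /ec_slope /= (negPf neX) cubic_p2 cubic_p3.
have nz : x' - x != 0 by rewrite subr_eq0 eq_sym.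
have -> : (y' / 3%:R - y / 3%:R) / (x' / 3%:R - x / 3%:R) = l.
  by rewrite -!mulrBl /l; field.
by congr (Some (_, _)); rewrite /x''; field.
Qed.

Lemma at_double P x y : at_pt P x y -> y != 0 ->
  let l := (3%:R * x ^+ 2 + B%:~R) / (2%:R * y) in let x'' := l ^+ 2 - x - x in
  at_pt (P + P) x'' (- (y + l * (x'' - x))).
Proof.
move=> + y0 l x''; rewrite /at_pt /= => ->.
have neY : y / 3%:R == - (y / 3%:R) = false.
  apply/negP => /eqP e; move/eqP: y0; apply.
  have -> : y = 3%:R / 2%:R * (y / 3%:R - - (y / 3%:R)) by field.
  by rewrite -e subrr mulr0.
rewrite /= eqxx neY /= /ec_slope /= eqxx cubic_p2 cubic_p3 horner_deriv_cubic_p.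
have -> : (9%:R * (x / 3%:R) ^+ 2 + 6%:R * p%:R ^+ 2) / (2%:R * (y / 3%:R)) = l.
  by rewrite /l coefE; field.
by congr (Some (_, _)); rewrite /x''; field.
Qed.

Lemma at_double0 P x : at_pt P x 0 -> P + P = 0.
Proof.
move=> eP; have e := at_opp eP; rewrite oppr0 in e.
by rewrite {2}(at_inj eP e) subrr.
Qed.

Lemma at_same_abscissa P Q x y y' : at_pt P x y -> at_pt Q x y' ->
  P = Q \/ P = - Q.
Proof.
move=> eP eQ; have /eqP : y ^+ 2 = y' ^+ 2 by rewrite (at_curve eP) (at_curve eQ).
rewrite eqf_sqr => /orP[]/eqP ey; rewrite ey in eP.
  by left; apply: at_inj eP eQ.
by right; apply: at_inj eP (at_opp eQ).
Qed.

End Points.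

(** * Descent *)

Section Descent.

Variables (p : nat) (p_pr : prime p) (p_mod : p = 17 %[mod 24]).
Variables (g h : 'F_p).
Hypotheses (g4 : g ^+ 4 = 2%:R) (h4 : h ^+ 4 = - 1).
Local Notation E := (E_ p_pr).
Local Notation B := (cubic_coef p).

Variables (R T : point E) (r yR : rat).
Hypotheses (r0 : r != 0) (atR : at_pt R (3%:R * p%:R * r ^+ 2) yR).
Hypothesis atT : at_pt T 0 0.

(** The point at infinity receives 1, the least possible height. *)
Definition pheight (P : point E) : int :=
  if coords P is Some (X, _) then height (3%:R * X) else 1.

Lemma pheight_at P x y : at_pt P x y -> pheight P = height x.
Proof. by rewrite /at_pt /pheight => ->; congr height; field. Qed.

Lemma pheight_ge1 P : 1 <= pheight P.
Proof. by rewrite /pheight; case: (coords P) => [[X Y]|] //; exact: height_ge1. Qed.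

Let pheight_ge0 P : 0 <= pheight P. Proof. exact: le_trans (pheight_ge1 P). Qed.
Let B1 : 1 <= B. Proof. exact: coef_ge1. Qed.
Let B0 : 0 <= B. Proof. exact: le_trans B1. Qed.
Let p0 : p%:R != 0 :> rat. Proof. by rewrite pnatr_eq0 -lt0n prime_gt0. Qed.
Let TT : T *+ 2 = 0. Proof. by rewrite mulr2n (at_double0 atT). Qed.
Let xR0 : 3%:R * p%:R * r ^+ 2 != 0.
Proof. by rewrite mulf_neq0 ?expf_neq0 // mulf_neq0. Qed.

Definition halving_const : int := 16%:R * B ^+ 3 * (1 + B).

Let K1 : 1 <= halving_const.
Proof.
have B31 : 1 <= B ^+ 3 by rewrite exprn_ege1.
have h1 : 1 <= 16%:R * B ^+ 3.
  by apply: (le_trans B31); apply: ler_peMl => //; apply: le_trans B31.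
apply: (le_trans h1); apply: ler_peMr; first exact: le_trans h1.
by rewrite lerDl.
Qed.
Let K0 : 0 <= halving_const. Proof. exact: le_trans K1. Qed.

(** As [B] is twice the square of [3 p], translation by [T] exchanges the class 2 with 1 and the
    class [6 p] with [3 p]. *)
Lemma at_add_torsion Q x y : at_pt Q x y -> x != 0 ->
  exists y', at_pt (Q + T) (B%:~R / x) y'.
Proof.
move=> atQ x0; have := at_add atQ atT x0; rewrite !sub0r.
move=> /= atQT; exists (- (y + (- y / - x) * ((- y / - x) ^+ 2 - x - 0 - x))).
suff <- : (- y / - x) ^+ 2 - x - 0 = B%:~R / x by [].
have -> : (- y / - x) ^+ 2 = y ^+ 2 / x ^+ 2 by field.
by rewrite (at_curve atQ); field.
Qed.

(** The relation is twice [Q = 2 Q1]: doubling kills 2-torsion, which covers the case [s = 0] and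
    later allows [P] to be replaced by [P + T]. *)
Lemma halve_square Q s y : at_pt Q (s ^+ 2) y ->
  exists Q1, Q *+ 2 = Q1 *+ 4 /\ pheight Q1 ^+ 4 <= halving_const * pheight Q.
Proof.
move=> atQ; have [s0|s0] := eqVneq s 0.
  exists 0; rewrite mul0rn; split.
    have /eqP := at_curve atQ; rewrite s0 !expr0n /= mulr0 addr0 expf_eq0 /=.
    by move=> /eqP y0; rewrite mulr2n; apply: (@at_double0 _ _ _ (s ^+ 2)); rewrite -y0.
  rewrite expr1n -[1]mulr1; apply: ler_pM => //; exact: pheight_ge1.
have [u [v [v0 euv ex ey hle]]] := halving p_pr p_mod g4 h4 s0 (at_curve atQ).
have [Q1 atQ1] := at_exists p_pr euv.
exists Q1; split; last by rewrite (pheight_at atQ1) (pheight_at atQ).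
have := at_double atQ1 v0; rewrite /= -ex -ey => atQ11.
by rewrite (at_inj atQ atQ11) -mulr2n -mulrnA.
Qed.

Lemma chord_square : exists C, forall Q x z y,
  at_pt Q x y -> x = 3%:R * p%:R * z ^+ 2 -> z != 0 ->
  x != 3%:R * p%:R * r ^+ 2 ->
  pheight (Q + R) <= C * pheight Q ^+ 2 /\
  exists s y', at_pt (Q + R) (s ^+ 2) y'.
Proof.
have [C hC] := height_add B1 (at_curve atR).
exists C => Q x z y atQ ex z0 ne.
have atQR := at_add atQ atR ne.
split.
  rewrite (pheight_at atQR) (pheight_at atQ); apply: hC => //.
  exact: at_curve atQ.
move: atQR => /=; rewrite (chord_abscissa ne (at_curve atQ) (at_curve atR)).
pose xR : rat := 3%:R * p%:R * r ^+ 2; rewrite -/xR in ne *.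
set x3 := _ / _ => atQR.
(* The line through [Q] and [R] meets the curve at abscissas whose product is the square of its
   intercept [(y xR - yR x) / (xR - x)], and [x * xR] is the square of [3 p z r]. *)
exists ((y * xR - yR * x) / (3%:R * p%:R * z * r * (x - xR))).
have -> : ((y * xR - yR * x) / (3%:R * p%:R * z * r * (x - xR))) ^+ 2 = x3.
  have nz : x - xR != 0 by rewrite subr_eq0.
  rewrite expr_div_n.
  have -> : (y * xR - yR * x) ^+ 2 =
    x * xR * ((x * xR + B%:~R) * (x + xR) - 2%:R * y * yR).
    transitivity
      (y ^+ 2 * xR ^+ 2 + yR ^+ 2 * x ^+ 2 - 2%:R * y * yR * x * xR); first by ring.
    by rewrite (at_curve atQ) (at_curve atR) -/xR; ring.
  have -> : (3%:R * p%:R * z * r * (x - xR)) ^+ 2 = x * xR * (x - xR) ^+ 2.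
    by rewrite exprMn; congr (_ * _); rewrite ex /xR; ring.
  have x0 : x != 0 by rewrite ex mulf_neq0 ?expf_neq0 // mulf_neq0.
  by rewrite /x3; field; rewrite x0 (xR0 : xR != 0) nz.
by eexists; exact: atQR.
Qed.

(** Unless [Q] is [R] or [- R], the sum [Q + R] has a square abscissa and can be halved. In the two
    exceptional cases [Q1] is [R] or 0, which explains the alternative bound. *)
Lemma descent_third_class : exists C : int, forall Q z y,
  at_pt Q (3%:R * p%:R * z ^+ 2) y -> z != 0 ->
  exists Q1, (exists e : bool, Q *+ 2 + R *+ (2 * e) = Q1 *+ 4) /\
    (pheight Q1 <= pheight R \/
     pheight Q1 ^+ 4 <= halving_const * `|C| * pheight Q ^+ 2).
Proof.
have [C hC] := chord_square; exists C => Q z y atQ z0.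
have [ex|ne] := eqVneq (3%:R * p%:R * z ^+ 2) (3%:R * p%:R * r ^+ 2).
  rewrite ex in atQ; have [->|->] := at_same_abscissa atQ atR.
    exists R; split; last by left.
    by exists true; rewrite -mulrnDr.
  exists 0; split; last by left; exact: pheight_ge1.
  by exists true; rewrite mulNrn addNr mul0rn.
have [hle [s [y' atQR]]] := hC _ _ _ _ atQ erefl z0 ne.
have [Q1 [eQ1 hQ1]] := halve_square atQR.
exists Q1; split; first by exists true; rewrite -mulrnDl eQ1.
right; apply: (le_trans hQ1); rewrite -mulrA; apply: ler_wpM2l => //.
apply: (le_trans hle); apply: ler_wpM2r; first exact: sqr_ge0.
exact: ler_norm.
Qed.

(** According to the class of its abscissa, one of [P], [P + T], [P + R], [P + T + R] is halved.
    Halving gains a fourth root while the translations cost at most a square, so heights cannot grow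
    beyond a fixed bound. *)
Lemma descent_step : exists N, forall P, exists P1,
  (exists e : bool, P *+ 2 + R *+ (2 * e) = P1 *+ 4) /\
  pheight P1 <= Num.max (pheight P) N.
Proof.
have [C hC] := descent_third_class.
(* [M] dominates the constants of all four classes, including the factor [B ^+ 2] due to squaring
   the height of [P + T]. *)
pose M := halving_const * (1 + `|C|) * B ^+ 2.
have BB : 1 <= B ^+ 2 by rewrite exprn_ege1.
have C1 : 1 <= 1 + `|C| by rewrite lerDl.
have M0 : 0 <= M.
  by rewrite /M; apply: mulr_ge0; [apply: mulr_ge0 => //; apply: le_trans C1
    | apply: le_trans BB].
(* If [pheight P1] exceeded [pheight P], its fourth power would be at most [M] times its square, so
   it would be at most [M]. *)
have close P P1 : pheight P1 ^+ 4 <= M * pheight P ^+ 2 ->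
    pheight P1 <= Num.max (pheight P) (Num.max M (pheight R)).
  move=> hle; rewrite !le_max; case: leP => //= lt_h.
  have h_gt0 : 0 < pheight P1 by apply: lt_le_trans (pheight_ge1 _).
  have : pheight P1 ^+ 2 <= M.
    rewrite -(@ler_pM2r _ (pheight P1 ^+ 2)) ?exprn_gt0 // -exprD.
    apply: (le_trans hle); apply: ler_wpM2l => //.
    by rewrite lerXn2r ?nnegrE // ltW.
  move=> hM; apply/orP; left; apply: le_trans hM; rewrite expr2.
  by apply: ler_peMl; [exact: ltW | exact: pheight_ge1].
have sqr_le t : 1 <= t -> t <= t ^+ 2 :> int.
  by move=> t1; rewrite expr2; apply: ler_peMl => //; apply: le_trans t1.
have le_M1 : halving_const * B <= M.
  rewrite /M -mulrA; apply: ler_wpM2l => //.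
  apply: (le_trans (sqr_le _ B1)); apply: ler_peMl => //; apply: le_trans BB.
have le_M2 : halving_const <= M.
  by apply: le_trans le_M1; apply: ler_peMr.
have le_M3 : halving_const * `|C| * B ^+ 2 <= M.
  rewrite /M; apply: ler_wpM2r; first by apply: le_trans BB.
  by apply: ler_wpM2l => //; rewrite lerDr.
exists (Num.max M (pheight R)) => P.
have hP2 : pheight P <= pheight P ^+ 2 by apply: sqr_le; exact: pheight_ge1.
have hP20 : 0 <= pheight P ^+ 2 by exact: sqr_ge0.
have [->|[x [y atP]]] := at_ptP P.
  exists 0; split; last by rewrite le_max lexx.
  by exists false; rewrite !mul0rn muln0 mulr0n addr0.
have [x_0|x0] := eqVneq x 0.
  have y_0 : y = 0.
    have /eqP := at_curve atP; rewrite x_0 expr0n mulr0 addr0 expf_eq0 /=.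
    by move/eqP.
  rewrite x_0 y_0 in atP; exists 0; split.
    exists false; rewrite mul0rn muln0 mulr0n addr0.
    by rewrite mulr2n (at_double0 atP).
  by rewrite le_max; apply/orP; left; exact: pheight_ge1.
have [y' atPT] := at_add_torsion atP x0.
have hPT : pheight (P + T) <= B * pheight P.
  by rewrite (pheight_at atPT) (pheight_at atP); apply: height_div.
have PT2 : (P + T) *+ 2 = P *+ 2 by rewrite mulrnDl TT addr0.
have [z [z0]] : exists z, z != 0 /\ [\/ x = z ^+ 2, x = 2%:R * z ^+ 2,
    x = 3%:R * p%:R * z ^+ 2 | x = 6%:R * p%:R * z ^+ 2].
  apply: (primal_class p_pr p_mod g4 h4 x0 (y := y)).
  by rewrite (at_curve atP) coefE.
case=> ex.
- rewrite ex in atP; have [P1 [eP1 hP1]] := halve_square atP.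
  exists P1; split; first by exists false; rewrite muln0 mulr0n addr0.
  apply: close; apply: (le_trans hP1).
  by apply: ler_pM.
- have ex' : B%:~R / x = (3%:R * p%:R / z) ^+ 2 by rewrite ex coefE; field.
  rewrite ex' in atPT; have [P1 [eP1 hP1]] := halve_square atPT.
  exists P1; split; first by exists false; rewrite muln0 mulr0n addr0 -PT2.
  apply: close; apply: (le_trans hP1).
  apply: (@le_trans _ _ (halving_const * (B * pheight P))).
    by apply: ler_wpM2l.
  by rewrite mulrA; apply: ler_pM => //; apply: mulr_ge0.
- rewrite ex in atP; have [P1 [eP1 hP1]] := hC _ _ _ atP z0.
  exists P1; split=> //; case: hP1 => hP1; first by rewrite !le_max hP1 !orbT.
  apply: close; apply: (le_trans hP1); apply: ler_wpM2r => //.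
  apply: le_trans le_M3; apply: ler_peMr => //; apply: mulr_ge0 => //.
- have ex' : B%:~R / x = 3%:R * p%:R * (z^-1) ^+ 2.
    by rewrite ex coefE; field; rewrite z0 p0.
  rewrite ex' in atPT; have [|P1 [eP1 hP1]] := hC _ _ _ atPT.
    by rewrite invr_eq0.
  exists P1; split; first by rewrite PT2 in eP1.
  case: hP1 => hP1; first by rewrite !le_max hP1 !orbT.
  apply: close; apply: (le_trans hP1).
  apply: (@le_trans _ _ (halving_const * `|C| * (B * pheight P) ^+ 2)).
    by apply: ler_wpM2l; [apply: mulr_ge0 | rewrite lerXn2r ?nnegrE // mulr_ge0].
  by rewrite exprMn mulrA; apply: ler_wpM2r.
Qed.

End Descent.

(** * Rank one *)

(** The Northcott property: the numerators, enumerated by naturals shifted by [M], and the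
    denominators range over finite sets. *)
Lemma height_finite (N : int) : exists L : seq rat, forall x, height x <= N -> x \in L.
Proof.
pose M := `|N|%N.
exists [seq (m%:Z - M%:Z)%:~R / (n%:Z)%:~R | m <- iota 0 (M + M).+1, n <- iota 0 M.+1].
move=> x hx; have hN := le_trans (num_le_height x) hx.
have hD := le_trans (den_le_height x) hx.
have hd := denq_gt0 x.
apply/allpairsP; exists (absz (numq x + M%:Z), absz (denq x)); split.
- by rewrite mem_iota /=; lia.
- by rewrite mem_iota /=; lia.
- rewrite /=; have -> : (absz (numq x + M%:Z))%:Z - M%:Z = numq x by lia.
  have -> : (absz (denq x))%:Z = denq x by lia.
  by rewrite divq_num_den.
Qed.

(** The [q]-adic valuation of [q * c] is 1, which is odd. *)
Lemma rat_nonsquare (q c : nat) (r : rat) :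
  prime q -> ~~ (q %| c)%N -> r ^+ 2 != (q * c)%N%:R.
Proof.
move=> q_pr qc; apply/eqP => e; have [m em] := rat_sqr_int (e : _ = (Posz _)%:~R).
have eZ : m ^+ 2 = (q * c)%N.
  by apply: (@intr_inj rat); rewrite rmorphXn /= -em e.
have eN : (`|m| ^ 2 = q * c)%N by rewrite -abszX eZ.
have : (q %| `|m| ^ 2)%N by rewrite eN dvdn_mulr.
rewrite Euclid_dvdX // andbT => /dvdnP[k ek]; move: eN; rewrite ek expnMn => e2.
move: qc; apply/negP; rewrite negbK; apply/dvdnP; exists (k ^ 2)%N.
have q_gt0 := prime_gt0 q_pr.
by apply/eqP; rewrite -(eqn_pmul2l q_gt0) -e2; apply/eqP; ring.
Qed.

(* The terms of the descent starting at Q have bounded height, so two of them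
   agree up to sign; eliminating them yields a relation between Q and R. *)
Section Dependence.

Variables (p : nat) (p_pr : prime p).
Local Notation E := (E_ p_pr).
Variables (R : point E) (N : int).
Hypothesis step : forall P : point E, exists P1,
  (exists e : bool, P *+ 2 + R *+ (2 * e) = P1 *+ 4) /\
  pheight P1 <= Num.max (pheight P) N.

(** The boolean form lets [xchoose] turn the descent step into a function that can be iterated. *)
Let next_ex (P : point E) : exists P1 : point E,
  (pheight P1 <= Num.max (pheight P) N) &&
  [exists e : bool, P *+ 2 + R *+ (2 * e) == P1 *+ 4].
Proof.
have [P1 [[e eP1] hP1]] := step P; exists P1; rewrite hP1.
by apply/existsP; exists e; rewrite eP1.
Qed.

Let next (P : point E) : point E := xchoose (next_ex P).

Let next_height P : pheight (next P) <= Num.max (pheight P) N.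
Proof. by case/andP: (xchooseP (next_ex P)). Qed.

Let next_eq P : exists n : int, P *~ 2 = R *~ n + next P *~ 4.
Proof.
case/andP: (xchooseP (next_ex P)) => _ /existsP[e /eqP eP].
exists (- (2 * e)%N%:Z); rewrite mulrNz -!pmulrn -[X in _ = _ + X]eP.
by rewrite addrC addrK.
Qed.

Let iter_height Q k : pheight (iter k next Q) <= Num.max (pheight Q) N.
Proof.
elim: k => [|k IHk] /=; first by rewrite le_max lexx.
by apply: le_trans (next_height _) _; rewrite ge_max IHk le_max lexx orbT.
Qed.

(** The induction multiplies [2 Q_k = m R + 4 Q_(k+1)] by [2 ^+ k], where [Q_k] is the [k]-th
    iterate. *)
Let iter_eq Q k : exists n : int,
  Q *~ 2 = R *~ n + iter k next Q *~ (2 ^+ k.+1).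
Proof.
elim: k => [|k [n ->]] /=; first by exists 0; rewrite mulr0z add0r.
have [m em] := next_eq (iter k next Q); exists (n + m * 2 ^+ k).
rewrite (exprS _ k) mulrzA em mulrzDl -!mulrzA mulrzDr addrA.
by congr (_ + _ *~ _); rewrite !exprS; ring.
Qed.

Definition abscissa (P : point E) : option rat :=
  omap (fun c => 3%:R * c.1) (coords P).

Lemma abscissa_eq P Q : abscissa P = abscissa Q -> P = Q \/ P = - Q.
Proof.
rewrite /abscissa; have [->|[x [y atP]]] := at_ptP P;
  have [->|[x' [y' atQ]]] := at_ptP Q.
- by left.
- by rewrite atQ.
- by rewrite atP.
- rewrite [coords P]atP [coords Q]atQ /= => -[/mulfI exx].
  have {}exx : x = x' by apply: (mulIf (_ : 3%:R^-1 != 0)) => //; apply: exx.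
  by rewrite exx in atP; exact: at_same_abscissa atP atQ.
Qed.

Lemma descent_dependent (Q : point E) :
  exists a b : int, a != 0 /\ Q *~ a = R *~ b.
Proof.
have [L hL] := height_finite (Num.max (pheight Q) N).
pose L' := None :: map Some L.
pose F k := abscissa (iter k next Q).
have FL k : F k \in L'.
  have := iter_height Q k; rewrite /F /abscissa /pheight /L'.
  case: (coords _) => [[X Y]|] /=; last by rewrite inE.
  by move/hL => XL; rewrite inE /=; apply: map_f.
(* Pigeonhole: one more term than the list of possible abscissas, with infinity included as
   [None]. *)
have : ~~ uniq (map F (iota 0 (size L').+1)).
  apply/negP => un; have := uniq_leq_size un (s2 := L').
  rewrite size_map size_iota ltnn => H; suff: false by [].
  by apply: H => _ /mapP[k _ ->].
case/(uniqPn None) => i [j [ltij]]; rewrite size_map size_iota => ltj.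
have lti := ltn_trans ltij ltj.
rewrite !(nth_map 0%N) ?size_iota // !nth_iota // !add0n => /esym/abscissa_eq eij.
have [d ed] : exists d, j = (i + d.+1)%N by exists (j - i).-1; lia.
have [n en] := iter_eq Q i; have [m em] := iter_eq Q j.
have [e [e1 ee]] : exists e : int, (e = 1 \/ e = -1) /\
    iter j next Q = iter i next Q *~ e.
  case: eij => ->; first by exists 1; rewrite mulr1z; split=> //; left.
  by exists (-1); rewrite mulrNz mulr1z; split=> //; right.
(* The relation at [i], multiplied by [e * 2 ^+ d.+1], has the same last term as the relation at
   [j]; subtracting gives these coefficients. The first is nonzero because [e * 2 ^+ d.+1] is
   even. *)
exists (2 * (e * 2 ^+ d.+1 - 1)), (n * (e * 2 ^+ d.+1) - m); split.
  by apply/eqP; case: e1 => ->; rewrite exprS; move: (2 ^+ d) => t; lia.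
have key : iter j next Q *~ (2 ^+ j.+1) =
    iter i next Q *~ (2 ^+ i.+1) *~ (e * 2 ^+ d.+1).
  rewrite ee -!mulrzA; congr (_ *~ _).
  by rewrite ed -addSn exprD; ring.
rewrite mulrzA mulrzBr mulr1z {1}en mulrzDl -key em.
by rewrite opprD addrACA subrr addr0 mulrzBr !mulrzA.
Qed.

End Dependence.

(** * Infinite order of a point in the class [3 p] *)

Section InfiniteOrder.

Variables (p : nat) (p_pr : prime p) (p_mod : p = 17 %[mod 24]).
Local Notation E := (E_ p_pr).
Variables (R T : point E) (r yR : rat).
Hypotheses (r0 : r != 0) (atR : at_pt R (3%:R * p%:R * r ^+ 2) yR).
Hypothesis atT : at_pt T 0 0.

Let p0 : p%:R != 0 :> rat. Proof. by rewrite pnatr_eq0 -lt0n prime_gt0. Qed.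
Let xR0 : 3%:R * p%:R * r ^+ 2 != 0.
Proof. by rewrite mulf_neq0 ?expf_neq0 // mulf_neq0. Qed.

(** The doubling formula reads [x(2 Q) = ((u^2 - B) / (2 v))^2]; it is nonzero because
    [B = 2 (3 p)^2] is not a square. *)
Lemma double_abscissa_square (Q : point E) x y : at_pt (Q + Q) x y ->
  exists2 s, s != 0 & x = s ^+ 2.
Proof.
move=> at2; have [Q0|[u [v atQ]]] := at_ptP Q.
  by move: (at_not0 at2); rewrite Q0 addr0 eqxx.
have [v0|v0] := eqVneq v 0.
  by move: (at_not0 at2); rewrite v0 in atQ; rewrite (at_double0 atQ) eqxx.
have [-> _] := at_uniq at2 (at_double atQ v0).
exists ((u ^+ 2 - (cubic_coef p)%:~R) / (2%:R * v)).
  rewrite mulf_neq0 ?invr_eq0 ?mulf_neq0 // subr_eq0 coefE; apply/eqP => eu.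
  have /eqP[] := @rat_nonsquare 2 1 (u / (3%:R * p%:R)) isT isT.
  by rewrite expr_div_n eu; field.
have v2 := at_curve atQ.
have c1 : ((3%:R * u ^+ 2 + (cubic_coef p)%:~R) / (2%:R * v)) ^+ 2 - u - u =
  ((3%:R * u ^+ 2 + (cubic_coef p)%:~R) ^+ 2 - 8%:R * u * v ^+ 2) / (2%:R * v) ^+ 2.
  by field.
by rewrite c1 v2 expr_div_n; congr (_ / _); ring.
Qed.

(** Strong induction on [m]. For odd [m], [R] would be a double although [3 p] is not a square. For
    [m = 2 k], the point [k R] has order 2 and equals [T]. Then [k] odd makes [R + T] a double
    although [6 p] is not a square, and [k] even makes [T] a double although its abscissa is 0. *)
Lemma third_class_infinite_order (m : nat) : (0 < m)%N -> R *+ m != 0.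
Proof.
have [n] := ubnP m; elim: n m => // n IHn m; rewrite ltnS => le_mn m_gt0.
apply/eqP => Rm0.
have not_double k : R != (R *+ k) *- 2.
  apply/eqP => eR; rewrite -mulNrn mulr2n in eR.
  have := atR; rewrite {1}eR => /double_abscissa_square[s s0 es].
  have /eqP ns : (s / r) ^+ 2 != (3 * p)%N%:R.
    by apply: rat_nonsquare => //; rewrite dvdn_prime2 //; apply/eqP; lia.
  by apply: ns; rewrite expr_div_n -es natrM; field.
have mE := odd_double_half m; case: (odd m) mE => /= mE.
  rewrite -mE add1n mulrS -muln2 mulrnA in Rm0.
  by have /eqP[] := not_double m./2; apply/eqP; rewrite -addr_eq0 Rm0.
rewrite add0n in mE; set k := m./2 in mE; rewrite -mE -muln2 mulrnA in Rm0.
have k_gt0 : (0 < k)%N by rewrite -double_gt0 mE.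
have Rk0 : R *+ k != 0.
  apply: IHn => //; apply: leq_trans le_mn.
  by rewrite -mE -addnn -[X in (X < _)%N]addn0 ltn_add2l.
have [eR|[u [v atRk]]] := at_ptP (R *+ k); first by rewrite eR eqxx in Rk0.
have [v0|v0] := eqVneq v 0; last first.
  by have /negP[] := at_not0 (at_double atRk v0); rewrite -mulr2n Rm0.
have u0 : u = 0.
  have /eqP := at_curve atRk; rewrite v0 expr0n /= eq_sym.
  have -> : u ^+ 3 + (cubic_coef p)%:~R * u = u * (u ^+ 2 + (cubic_coef p)%:~R) by ring.
  rewrite mulf_eq0 => /orP[/eqP//|]; rewrite gt_eqF //.
  apply: ltr_wpDl; first exact: sqr_ge0.
  by rewrite ltr0z gtz0_ge1 coef_ge1.
rewrite u0 v0 in atRk; have RkT := at_inj atRk atT.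
have lE := odd_double_half k; case: (odd k) lE => /= lE.
  rewrite -lE add1n mulrS -muln2 mulrnA in RkT.
  have [y' atRT] := at_add_torsion atT atR xR0.
  have RT : R + T = - (R *+ k./2) + - (R *+ k./2).
    have TN : T = - T.
      by apply: at_inj atT _; rewrite -[X in at_pt _ _ X]oppr0; apply: at_opp.
    by rewrite TN -RkT opprD addrA subrr add0r mulr2n opprD.
  rewrite RT in atRT; have [s s0 es] := double_abscissa_square atRT.
  have /eqP ns : (s * r) ^+ 2 != (3 * (2 * p))%N%:R.
    apply: rat_nonsquare => //; rewrite Euclid_dvdM // dvdn_prime2 //=.
    by apply/eqP; lia.
  by apply: ns; rewrite exprMn -es coefE !natrM; field; rewrite p0 r0.
rewrite add0n in lE; rewrite -lE -muln2 mulrnA mulr2n in atRk.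
have [s s0 /esym/eqP] := double_abscissa_square atRk.
by rewrite expf_eq0 (negPf s0).
Qed.

End InfiniteOrder.

Lemma has_rank1 (V : zmodType) (R : V) :
  (forall m : nat, (0 < m)%N -> R *+ m != 0) ->
  (forall Q : V, exists a b : int, a != 0 /\ Q *~ a = R *~ b) ->
  has_rank V 1.
Proof.
move=> infR dep; split.
  exists (fun=> R) => m; rewrite big_ord1 => mR i; rewrite [i]ord1.
  have [//|m0] := eqVneq (m ord0) 0.
  have := infR `|m ord0|%N; rewrite absz_gt0 => /(_ m0)/eqP[].
  case: (m ord0) mR => k /=; first by rewrite pmulrn.
  by rewrite NegzE mulrNz -pmulrn => /eqP; rewrite oppr_eq0 => /eqP.
case=> [|[|n]] // P indep.
pose i0 : 'I_n.+2 := ord0; pose i1 : 'I_n.+2 := ord_max.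
have [a0 [b0 [a00 e0]]] := dep (P i0); have [a1 [b1 [a10 e1]]] := dep (P i1).
have ne : i1 != i0 by [].
(* Eliminating [R] gives [a0 b1 P0 - a1 b0 P1 = 0], which could be trivial when [b0 = 0]; in that
   case [a0 P0 = 0] serves instead. *)
pose c0 := if b0 == 0 then a0 else a0 * b1.
pose c1 := if b0 == 0 then 0 else - (a1 * b0).
pose m i := if i == i0 then c0 else if i == i1 then c1 else 0.
have : \sum_(i < n.+2) P i *~ m i = 0.
  rewrite (bigD1 i0) //= (bigD1 i1) //= big1 ?addr0 => [|i /andP[/negPf i_0 /negPf i_1]].
    rewrite /m eqxx (negPf ne) eqxx /c0 /c1; case: eqP => [b00|_].
      by rewrite e0 b00 !mulr0z addr0.
    by rewrite mulrNz !mulrzA e0 e1 -!mulrzA (mulrC b1) subrr.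
  by rewrite /m i_0 i_1 mulr0z.
move/indep => m0; have := m0 i0; have := m0 i1.
rewrite /m eqxx (negPf ne) eqxx /c0 /c1; case: eqP => [_ _ /eqP|/eqP b00 /eqP].
  by rewrite (negPf a00).
by rewrite oppr_eq0 mulf_eq0 (negPf a10) (negPf b00).
Qed.

(** If [p] divided [b] it would divide [a], so [p ^ 4] would divide [3 p], forcing [p = 3]. *)
Lemma coprime_quartic_form (p : nat) (a b : int) : prime p -> p != 3%N ->
  3 * p%:Z = a ^+ 4 + 2 * b ^+ 4 -> b%:~R != 0 :> 'F_p.
Proof.
move=> p_pr p3 rep; apply/eqP => b0.
have [b' eb] := intr_Fp_eq0 p_pr b0.
have p0 : p%:Z != 0 by rewrite eqz_nat -lt0n prime_gt0.
have [a' ea] : exists a', a = p%:Z * a'.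
  apply: (intr_Fp_eq0 p_pr); have := congr1 (fun n : int => n%:~R : 'F_p) rep.
  rewrite /= rmorphD rmorphXn !rmorphM /= (prime_intr_Fp p_pr) b0 mulr0 !mul0r mulr0 addr0.
  by move/esym/eqP; rewrite expf_eq0 => /eqP.
have : 3%:Z = p%:Z * (p%:Z ^+ 2 * (a' ^+ 4 + 2 * b' ^+ 4)).
  by apply: (mulIf p0); rewrite rep ea eb; ring.
move/(congr1 (fun n : int => n%:~R : 'F_p)).
rewrite rmorphM /= (prime_intr_Fp p_pr) mul0r; apply/eqP.
by apply: (@prime_lift_Fp p p_pr 3) => //; rewrite eq_sym.
Qed.

Theorem proposition0p2 (p : nat) (p_pr : prime p)
    (p_mod : p = 17 %[mod 24]) (quartic : quartic_symbol 2 p = 1)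
    (rep : exists a b : int, 3 * p%:Z = a ^+ 4 + 2 * b ^+ 4) :
  has_rank (point (E_ p_pr)) 1.
Proof.
have [a [b ab]] := rep.
have [g g4] : exists g : 'F_p, g ^+ 4 = 2%:R.
  move: quartic; rewrite /quartic_symbol; case: ifP => // /existsP[g /eqP g4] _.
  by exists g.
have p3 : p != 3%N by apply/eqP; clear -p_mod; lia.
have bF := coprime_quartic_form p_pr p3 ab.
have g0 : g != 0.
  apply/eqP => g0; move/esym/eqP: g4; rewrite g0 expr0n; apply/negP.
  by apply: (@prime_lift_Fp p p_pr 2) => //; apply/eqP; clear -p_mod; lia.
(* Modulo [p] the representation reads [a ^+ 4 = - 2 b ^+ 4] with [2 = g ^+ 4], so [a / (g b)] is a
   fourth root of -1. *)
have [h h4] : exists h : 'F_p, h ^+ 4 = - 1.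
  exists (a%:~R / (g * b%:~R)); have := congr1 (fun n : int => n%:~R : 'F_p) ab.
  rewrite /= !(rmorphXn, rmorphM, rmorphD, rmorph_nat) /= (prime_intr_Fp p_pr) mulr0.
  move/esym/eqP; rewrite addr_eq0 => /eqP aF.
  rewrite expr_div_n aF exprMn g4; field.
  by rewrite bF -g4 expf_neq0.
have b0 : b != 0 by apply: contraNneq bF => ->; rewrite mulr0z.
(* Otherwise [3 p = 2 b ^+ 4] would be even. *)
have a0 : a != 0.
  by apply/eqP => a0; move: ab; rewrite a0 expr0n; move: (b ^+ 4) => t; clear -p_mod; lia.
(* With this abscissa, [x^3 + B x] equals [27 p^3 a^2 / b^6] times [a^4 + 2 b^4 = 3 p], the square
   of the given ordinate. *)
have [R atR] : exists R : point (E_ p_pr),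
    at_pt R (3%:R * p%:R * (a%:~R / b%:~R) ^+ 2)
      (9%:R * p%:R ^+ 2 * a%:~R / b%:~R ^+ 3).
  apply: at_exists; rewrite coefE.
  have abQ : 3%:R * p%:R = a%:~R ^+ 4 + 2%:R * b%:~R ^+ 4 :> rat.
    by have := congr1 (fun n : int => n%:~R : rat) ab;
      rewrite /= !(rmorphXn, rmorphM, rmorphD, rmorph_nat).
  have bQ : b%:~R != 0 :> rat by rewrite intr_eq0.
  move: (p%:R : rat) (a%:~R : rat) (b%:~R : rat) abQ bQ => P A D abQ bQ.
  transitivity (27%:R * P ^+ 3 * A ^+ 2 / D ^+ 6 * (A ^+ 4 + 2%:R * D ^+ 4)).
    by rewrite -abQ; field.
  by field.
have [T atT] : exists T : point (E_ p_pr), at_pt T 0 0.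
  by apply: at_exists; rewrite !expr0n /= mulr0 addr0.
have r0 : a%:~R / b%:~R != 0 :> rat by rewrite mulf_neq0 ?invr_eq0 ?intr_eq0.
apply: (@has_rank1 _ R); first exact: third_class_infinite_order atR atT.
have [N step] := descent_step p_mod g4 h4 r0 atR atT.
exact: descent_dependent step.
Qed.
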